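(* Let $f\in\mathcal F$ be nonzero with $f=f^\ast$ (so $\ker f=\ker f^\ast$ and $\langle\;,\;\rangle_f$ is a pairing on $\ker f$). Then: (1) $\langle\alpha,\alpha\rangle_f=0$ for all $\alpha\in\ker f$. (2) If $h\in\mathcal F$ and $f=h^\ast\circ h$, then $\ker h$ is a maximal isotropic closed sub-$\mathbb F_q$-vector space of $\ker f$ under $\langle\;,\;\rangle_f$. (3) Conversely, if $H$ is a maximal isotropic closed sub-$\mathbb F_q$-vector space of $\ker f$ under $\langle\;,\;\rangle_f$, then there exists $h\in\mathcal F$ such that $f=h^\ast\circ h$ and $\ker h=H$.
   Context: Let $p$ be a prime, $q$ a power of $p$, and $C$ an algebraically closed field containing $\mathbb F_q$, complete with respect to a non-archimedean absolute value. $\mathcal F$ is the set of formal sums $f=\sum_{n\in\mathbb Z}a_n\tau^n$ ($a_n\in C$) such that $f(z)=\sum_na_nz^{q^n}$ converges for all $z\in C$ ($z^{q^n}$ for $n<0$ being the unique $q^{-n}$-th root); it is a ring under termwise addition and composition $(\sum a_i\tau^i)\circ(\sum b_j\tau^j)=\sum_n(\sum_{i+j=n}a_ib_j^{q^i})\tau^n$ (composition of maps), with $c\in C$ identified with multiplication by $c$. $\ker f=\{z\in C:f(z)=0\}$ with the topology from $C$. The adjoint is $f^\ast=\sum_na_n^{1/q^n}\tau^{-n}$. For nonzero $f$ and $\alpha\in\ker f$, $g_\alpha\in\mathcal F$ is the unique element with $f\circ\alpha=g_\alpha\circ(1-\tau)$, and $\langle\alpha,\beta\rangle_f=g_\alpha^\ast(\beta)\in\mathbb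 F_q$ for $\beta\in\ker f^\ast$; this is $\mathbb F_q$-bilinear. A subspace $H$ is isotropic if $\langle\alpha,\beta\rangle_f=0$ for all $\alpha,\beta\in H$. *)

(* Defs.v *)
From HB Require Import structures.
From mathcomp Require Export all_boot all_order all_algebra.
From mathcomp Require Export all_classical all_reals topology sequences.

Set Implicit Arguments.
Unset Strict Implicit.
Unset Printing Implicit Defensive.

Import Order.TTheory GRing.Theory Num.Theory.
Local Open Scope classical_set_scope.
Local Open Scope ring_scope.

(* The library's normed structures force characteristic 0 (they require
   `|x *+ n| = `|x| *+ n), hence this structure: absv_ball says that the
   uniformity and the topology are those of the metric absv (x - y). The
   trivial absolute value is not excluded. *)
HB.mixin Record PseudoMetric_isNonarchimedean (R : realType) C
    of GRing.Field C & PseudoPointedMetric R C := {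
  absv : C -> R ;
  absv_ge0 : forall x, 0 <= absv x ;
  absv_eq0 : forall x, absv x = 0 <-> x = 0 ;
  absvM : forall x y, absv (x * y) = absv x * absv y ;
  absvD_max : forall x y, absv (x + y) <= Num.max (absv x) (absv y) ;
  absv_ball : forall (x : C) (r : R), ball x r = [set y : C | absv (x - y) < r]
}.

#[short(type="completeNonarchClosedFieldType")]
HB.structure Definition CompleteNonarchClosedField (R : realType) :=
  { C of GRing.ClosedField C & CompletePseudoMetric R C
       & PseudoMetric_isNonarchimedean R C }.

Section TwistedSeries.
Variables (R : realType) (C : completeNonarchClosedFieldType R) (q : nat).

(* A sum over int converges when both of its halves do; Negz n = - n.+1. *)
Definition zsummable (u : int -> C) : Prop :=
  cvgn (series (fun n : nat => u (Posz n))) /\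
  cvgn (series (fun n : nat => u (Negz n))).

Definition zsum (u : int -> C) : C :=
  limn (series (fun n : nat => u (Posz n))) +
  limn (series (fun n : nat => u (Negz n))).

(* z ^ (q ^ n) for n : int. When q is a power of the characteristic of C the
   set in the second case is a singleton. *)
Definition frob (n : int) (z : C) : C :=
  match n with
  | Posz m => z ^+ (q ^ m)
  | Negz m => xget 0 [set y | y ^+ (q ^ m.+1) = z]
  end.

(* The function a : int -> C stands for the formal sum of the a n * tau ^ n. *)
Implicit Types (a b f g h : int -> C).

Definition evalT f (z : C) : C := zsum (fun n => f n * frob n z).

Definition entire : set (int -> C) :=
  [set f | forall z : C, zsummable (fun n => f n * frob n z)].

Definition compT a b : int -> C :=
  fun n => zsum (fun i => a i * frob i (b (n - i))).

Definition constT (c : C) : int -> C := fun n => if n == 0 then c else 0.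

Definition tauT : int -> C := fun n => if n == 1 then 1 else 0.

Definition one_sub_tau : int -> C := fun n => constT 1 n - tauT n.

(* The coefficient of tau ^ (- n) in the adjoint of a is (a n) ^ (1 / q ^ n). *)
Definition adjT a : int -> C := fun n => frob n (a (- n)).

Definition kerT f : set C := [set z | evalT f z = 0].

(* For f <> 0 in entire and alpha in kerT f, the set below is a singleton. *)
Definition gT f (alpha : C) : int -> C :=
  xget (fun=> 0)
    [set g | entire g /\ compT f (constT alpha) = compT g one_sub_tau].

Definition pairing f (alpha beta : C) : C := evalT (adjT (gT f alpha)) beta.

Definition Fq : set C := [set c | c ^+ q = c].

Definition Fq_subspace (H : set C) : Prop :=
  [/\ H 0, forall x y, H x -> H y -> H (x + y)
    & forall c x, Fq c -> H x -> H (c * x)].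

Definition closed_in (A H : set C) : Prop :=
  exists2 Z : set C, closed Z & H = A `&` Z.

Definition isotropic f (H : set C) : Prop :=
  forall alpha beta, H alpha -> H beta -> pairing f alpha beta = 0.

Definition isotropic_closed_subspace f (H : set C) : Prop :=
  [/\ H `<=` kerT f, Fq_subspace H, closed_in (kerT f) H & isotropic f H].

Definition maximal_isotropic_closed_subspace f (H : set C) : Prop :=
  isotropic_closed_subspace f H /\
  forall H', isotropic_closed_subspace f H' -> H `<=` H' -> H' = H.

End TwistedSeries.

(* Main.v *)
(* The kernel of a nonzero f in F is totally bounded in every ball, and f is onto
   with explicit control: if a_n y^(q^n) = w then f(z) = w for some |z| <= |y|
   (solve the truncations, which are polynomials up to a Frobenius twist, and
   iterate). Hence f is determined by its values.

   Pairing. With g_n = sum_(i <= n) a_i alpha^(q^i) = - sum_(i > n) a_i alpha^(q^i),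
   the pairing is <alpha, beta>_f = sum_n (g_n beta)^(q^-n), a difference of two
   absolutely convergent double series that passing to the adjoint exchanges; so
   <alpha, beta>_f = - <beta, alpha>_(adj f), and <alpha, alpha>_f = 0 when f = adj f.
   If f = g h then <alpha, beta>_f = <alpha, (adj g)(beta)>_h on ker h, and
   surjectivity of adj g_alpha makes the pairing nondegenerate. This gives (2).

   For (3), let v be a sequence dense in H. Dividing out the v_n one at a time, by
   binomials 1 - e tau or 1 - e tau^-1 with |e| <= 1, gives f = g_n h_n with g_n and
   h_n normalised; multiplicativity of the Gauss norm bounds them by f, total
   boundedness of ker f forces e -> 0, and in the limit f = g h with ker h = H,
   where h depends on v only. Maximality of H means ker (adj g) = H, so the same h
   divides adj g = u h, where u has trivial kernel and is therefore a monomial;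
   f = (adj h) (adj u) h = adj f forces u to be a constant c, and sqrt(c) h is the
   required factor. *)

Require Import Defs.
From mathcomp Require Import zify.

Set Implicit Arguments.
Unset Strict Implicit.
Unset Printing Implicit Defensive.

Import Order.TTheory GRing.Theory Num.Theory.
Local Open Scope classical_set_scope.
Local Open Scope ring_scope.

(** Nonzero series are onto, so identities in the ring can be read off values: associativity,
    cancellation and the final factorisation become statements about additive maps of [C]. The
    adjoint has no such description and is handled through coefficients and double series. The value
    group is arbitrary, possibly trivial, so points of [C] stand in for real radii: a Gauss norm is
    the largest |f_n z^(q^n)| for some [z], and Newton polygon arguments are made at points where
    two terms tie. Two kinds of binomials are needed because the zeros of a two-sided series may
    accumulate at 0 as well as go to infinity. For a root w they are 1 - w^(1-q) tau and 1 -
    w^(1-1/q) tau^-1, equal up to a monomial on the left; the first coefficient tends to 0 as w goes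
    to infinity, the second as w goes to 0. Normalisation fixes the monomial that a kernel leaves
    undetermined, so that the factors can converge. *)

Section AbsoluteValue.
Variables (R : realType) (C : completeNonarchClosedFieldType R).
Implicit Types (x y z : C) (eps : R).

(** * Ultrametric estimates and completeness *)

Lemma absv0 : absv (0 : C) = 0.
Proof. exact/absv_eq0. Qed.

Lemma absv_eq0P x : (absv x == 0) = (x == 0).
Proof. by apply/eqP/eqP => /absv_eq0. Qed.

Lemma absv_gt0 x : (0 < absv x) = (x != 0).
Proof. by rewrite lt0r absv_ge0 andbT absv_eq0P. Qed.

Lemma absv1 : absv (1 : C) = 1.
Proof.
have n0 : absv (1 : C) != 0 by rewrite absv_eq0P oner_neq0.
by apply: (mulfI n0); rewrite -absvM !mulr1.
Qed.

Lemma absvX x n : absv (x ^+ n) = absv x ^+ n.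
Proof.
by elim: n => [|n IH]; rewrite ?expr0 ?absv1 // !exprS absvM IH.
Qed.

Lemma absvN x : absv (- x) = absv x.
Proof.
have h1 : absv (-1 : C) = 1.
  apply/eqP; rewrite -(@pexpr_eq1 _ _ 2) ?absv_ge0 //.
  by rewrite -absvX sqrrN expr1n absv1.
by rewrite -mulN1r absvM h1 mul1r.
Qed.

Lemma absvB x y : absv (x - y) = absv (y - x).
Proof. by rewrite -absvN opprB. Qed.

Lemma absvV x : absv x^-1 = (absv x)^-1.
Proof.
have [->|x0] := eqVneq x 0; first by rewrite invr0 absv0 invr0.
have n0 : absv x != 0 by rewrite absv_eq0P.
by apply: (mulfI n0); rewrite -absvM !divff // absv1.
Qed.

Lemma absvD_lt x y eps : absv x < eps -> absv y < eps -> absv (x + y) < eps.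
Proof.
by move=> hx hy; apply: le_lt_trans (absvD_max _ _) _; rewrite gt_max hx hy.
Qed.

Lemma absvD_le x y eps : absv x <= eps -> absv y <= eps -> absv (x + y) <= eps.
Proof.
by move=> hx hy; apply: le_trans (absvD_max _ _) _; rewrite ge_max hx hy.
Qed.

Lemma absvB_lt x y eps : absv x < eps -> absv y < eps -> absv (x - y) < eps.
Proof. by move=> hx hy; apply: absvD_lt; rewrite ?absvN. Qed.

Lemma absvB_le x y eps : absv x <= eps -> absv y <= eps -> absv (x - y) <= eps.
Proof. by move=> hx hy; apply: absvD_le; rewrite ?absvN. Qed.

Lemma absv_dist_lt y x z eps :
  absv (x - y) < eps -> absv (y - z) < eps -> absv (x - z) < eps.
Proof. by move=> hx hy; rewrite -[x](subrK y) -addrA; apply: absvD_lt. Qed.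

Lemma absvD_eq x y : absv y < absv x -> absv (x + y) = absv x.
Proof.
move=> yx; apply/eqP; rewrite eq_le (absvD_le (lexx _) (ltW yx)) /=.
rewrite leNgt; apply/negP => h.
by have := absvB_lt h yx; rewrite addrK ltxx.
Qed.

Lemma absv_sum_lt (I : eqType) (s : seq I) (u : I -> C) eps : 0 < eps ->
  (forall i, i \in s -> absv (u i) < eps) -> absv (\sum_(i <- s) u i) < eps.
Proof.
move=> e0 h; rewrite big_seq; elim/big_rec: _ => [|i x si]; first by rewrite absv0.
by apply: absvD_lt; exact: h.
Qed.

Lemma absv_small_eq0 x : (forall eps, 0 < eps -> absv x < eps) -> x = 0.
Proof.
move=> h; apply/eqP; apply: contraT; rewrite -absv_gt0 => /h.
by rewrite ltxx.
Qed.

Lemma cvgn_absvP (x_ : nat -> C) (l : C) :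
  x_ n @[n --> \oo] --> l <->
  forall eps, 0 < eps -> exists N, forall n, (N <= n)%N -> absv (l - x_ n) < eps.
Proof.
rewrite cvg_ballP; split => h eps e0.
  have [N _ hN] := h eps e0; exists N => n Nn.
  by have := hN n Nn; rewrite /= absv_ball.
have [N hN] := h eps e0; exists N => // n Nn.
by rewrite /= absv_ball; exact: hN.
Qed.

(** A telescoping sum is no larger than its largest step, so small consecutive differences already
    make a sequence Cauchy. *)
Lemma absv_telescope (x_ : nat -> C) eps N : 0 < eps ->
  (forall n, (N <= n)%N -> absv (x_ n.+1 - x_ n) < eps) ->
  forall m n, (N <= m)%N -> (N <= n)%N -> absv (x_ m - x_ n) < eps.
Proof.
move=> e0 h.
have base m : (N <= m)%N -> absv (x_ m - x_ N) < eps.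
  elim: m => [|m IH]; first by rewrite leqn0 => /eqP ->; rewrite subrr absv0.
  rewrite leq_eqVlt => /predU1P[<-|]; first by rewrite subrr absv0.
  rewrite ltnS => Nm; exact: absv_dist_lt (h _ Nm) (IH Nm).
by move=> m n Nm Nn; apply: (absv_dist_lt (base _ Nm)); rewrite absvB; exact: base.
Qed.

Lemma absv_complete (x_ : nat -> C) :
  (forall eps, 0 < eps ->
     exists N, forall n, (N <= n)%N -> absv (x_ n.+1 - x_ n) < eps) ->
  cvgn x_.
Proof.
move=> h; apply: cauchy_cvg; apply/cauchy_ballP => eps e0.
have [N hN] := h eps e0.
pose A := [set x_ n | n in [set n | (N <= n)%N]].
have nA : (x_ n @[n --> \oo]) A by exists N => // n Nn; exists n.
exists (A, A) => //= -[_ _] [/= [m Nm <-] [n Nn <-]]; rewrite absv_ball /=.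
exact: absv_telescope hN _ _ Nm Nn.
Qed.

End AbsoluteValue.

(** * Unordered sums over arbitrary index types *)

Section Summation.
Variables (R : realType) (C : completeNonarchClosedFieldType R).
Implicit Types (eps : R) (I J : eqType).

(** Summation is unordered and allows any index type, so that double series over [int * int] can be
    rearranged and regrouped freely; terms tending to 0 suffice for a sum to exist ([is_sum_ex]). *)
Definition null_family I (u : I -> C) : Prop :=
  forall eps, 0 < eps ->
    exists s : seq I, forall i, i \notin s -> absv (u i) < eps.

Definition is_sum I (u : I -> C) (S : C) : Prop :=
  forall eps, 0 < eps -> exists s : seq I,
    forall t, uniq t -> {subset s <= t} -> absv (S - \sum_(i <- t) u i) < eps.

Lemma is_sum_unique I (u : I -> C) S T : is_sum u S -> is_sum u T -> S = T.
Proof.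
move=> hS hT; apply/eqP; rewrite -subr_eq0; apply/eqP/absv_small_eq0 => eps e0.
have [s hs] := hS _ e0; have [t ht] := hT _ e0.
have un : uniq (undup (s ++ t)) by exact: undup_uniq.
have h1 := hs _ un; have h2 := ht _ un.
apply: (absv_dist_lt (h1 _)).
  by move=> i si; rewrite mem_undup mem_cat si.
rewrite absvB; apply: h2 => i si.
by rewrite mem_undup mem_cat si orbT.
Qed.

Lemma is_sum_ex I (u : I -> C) : null_family u -> exists S, is_sum u S.
Proof.
move=> u0.
have /choice[s hs] : forall n : nat, exists s : seq I,
    forall i, i \notin s -> absv (u i) < n.+1%:R^-1.
  by move=> n; apply: u0; rewrite invr_gt0 ltr0n.
(* Outside [T n] all terms are below 1/(n+1), so the sums over these increasing finite sets form a
   Cauchy sequence. *)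
pose T n := undup (flatten [seq s k | k <- iota 0 n.+1]).
have sT n k : (k <= n)%N -> {subset s k <= T n}.
  move=> kn i ik; rewrite mem_undup; apply/flattenP; exists (s k) => //.
  by apply/mapP; exists k => //; rewrite mem_iota.
have key eps n t : 0 < eps -> (forall i, i \notin T n -> absv (u i) < eps) ->
    uniq t -> {subset T n <= t} ->
    absv (\sum_(i <- T n) u i - \sum_(i <- t) u i) < eps.
  move=> e0 h ut st; rewrite absvB.
  have pe : perm_eq [seq i <- t | i \in T n] (T n).
    apply: uniq_perm; rewrite ?filter_uniq ?undup_uniq // => i.
    rewrite mem_filter; case: (boolP (i \in T n)) => //= /st -> //.
  rewrite [X in X - _](bigID (mem (T n))) /= -big_filter (perm_big _ pe) /=.
  rewrite addrAC subrr add0r -big_filter; apply: absv_sum_lt => // i.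
  by rewrite mem_filter => /andP[/h].
have small eps : 0 < eps -> exists N, forall n, (N <= n)%N ->
    forall i, i \notin T n -> absv (u i) < eps.
  move=> e0; have [N hN] : exists N : nat, N.+1%:R^-1 < eps.
    exists (Num.truncn eps^-1); rewrite -[ltRHS]invrK ltf_pV2 ?posrE ?invr_gt0 ?ltr0n //.
    exact: truncnS_gt.
  exists N => n Nn i iT; apply: lt_trans hN; apply: hs.
  by apply: contra iT; exact: sT.
have TT n m : (n <= m)%N -> {subset T n <= T m}.
  move=> nm i; rewrite mem_undup => /flattenP[_ /mapP[k + ->]] ik.
  rewrite mem_iota /= add0n ltnS => kn; apply: (@sT _ k) ik; exact: leq_trans nm.
pose x_ n := \sum_(i <- T n) u i.
have cx : cvgn x_.
  apply: absv_complete => eps e0; have [N hN] := small _ e0.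
  exists N => n Nn; rewrite absvB; apply: key => //; first exact: hN.
    exact: undup_uniq.
  exact: TT.
have [l hl] := (cvg_ex _).1 cx.
exists l => eps e0; have [N hN] := small _ e0.
have [M hM] := (cvgn_absvP _ _).1 hl _ e0.
exists (T (maxn M N)) => t ut st.
apply: (absv_dist_lt (hM _ (leq_maxl M N))); apply: key => //.
by apply: hN; exact: leq_maxr.
Qed.

(** Strictness survives the limit: [S] is closer than [eps] to a finite sum, and a finite maximum of
    values below [eps] is below [eps]. *)
Lemma is_sum_lt I (u : I -> C) S eps : is_sum u S -> 0 < eps ->
  (forall i, absv (u i) < eps) -> absv S < eps.
Proof.
move=> hS e0 hu; have [s hs] := hS _ e0.
have h : absv (S - \sum_(i <- undup s) u i) < eps.
  by apply: hs; [exact: undup_uniq | move=> i; rewrite mem_undup].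
rewrite -[S](subrK (\sum_(i <- undup s) u i)).
by apply: absvD_lt => //; apply: absv_sum_lt.
Qed.

Lemma is_sum_le I (u : I -> C) S eps : is_sum u S -> 0 <= eps ->
  (forall i, absv (u i) <= eps) -> absv S <= eps.
Proof.
move=> hS e0 hu; apply/ler_addgt0Pr => d d0.
apply/ltW/(is_sum_lt hS); first by rewrite ltr_wpDl.
by move=> i; apply: le_lt_trans (hu i) _; rewrite ltrDl.
Qed.

Lemma eq_is_sum I (u v : I -> C) S : u =1 v -> is_sum u S -> is_sum v S.
Proof. by move=> /funext ->. Qed.

Lemma eq_null I (u v : I -> C) : u =1 v -> null_family u -> null_family v.
Proof. by move=> /funext ->. Qed.

Lemma null_le I (u v : I -> C) :
  (forall i, absv (v i) <= absv (u i)) -> null_family u -> null_family v.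
Proof.
move=> h hu eps /hu[s hs]; exists s => i /hs; exact: le_lt_trans (h i).
Qed.

Lemma nullD I (u v : I -> C) :
  null_family u -> null_family v -> null_family (fun i => u i + v i).
Proof.
move=> hu hv eps e0; have [s hs] := hu _ e0; have [t ht] := hv _ e0.
exists (s ++ t) => i; rewrite mem_cat negb_or => /andP[/hs ? /ht ?].
exact: absvD_lt.
Qed.

Lemma nullN I (u : I -> C) : null_family u -> null_family (fun i => - u i).
Proof. by apply: null_le => i; rewrite absvN. Qed.

Lemma nullB I (u v : I -> C) :
  null_family u -> null_family v -> null_family (fun i => u i - v i).
Proof. by move=> hu hv; apply: nullD => //; exact: nullN. Qed.

Lemma is_sumD I (u v : I -> C) S T : is_sum u S -> is_sum v T ->
  is_sum (fun i => u i + v i) (S + T).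
Proof.
move=> hS hT eps e0; have [s hs] := hS _ e0; have [t ht] := hT _ e0.
exists (s ++ t) => r ur sr; rewrite big_split /= opprD addrACA.
by apply: absvD_lt; [apply: hs | apply: ht] => // i ii; apply: sr;
   rewrite mem_cat ii ?orbT.
Qed.

Lemma is_sum_morph I (phi : C -> C) (u : I -> C) S :
  {morph phi : x y / x - y} ->
  (forall eps, 0 < eps ->
     exists2 d, 0 < d & forall x, absv x < d -> absv (phi x) < eps) ->
  is_sum u S -> is_sum (fun i => phi (u i)) (phi S).
Proof.
move=> phiB phic hS eps e0; have [d d0 hd] := phic _ e0; have [s hs] := hS _ d0.
have phi0 : phi 0 = 0 by have := phiB 0 0; rewrite !subrr.
have phiN x : phi (- x) = - phi x by have := phiB 0 x; rewrite phi0 !sub0r.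
have phiD : {morph phi : x y / x + y}.
  by move=> x y; rewrite -[y in LHS]opprK phiB phiN opprK.
exists s => t ut st; rewrite -(big_morph phi phiD phi0) -phiB; apply: hd.
exact: hs.
Qed.

Lemma null_morph I (phi : C -> C) (u : I -> C) :
  (forall eps, 0 < eps ->
     exists2 d, 0 < d & forall x, absv x < d -> absv (phi x) < eps) ->
  null_family u -> null_family (fun i => phi (u i)).
Proof.
move=> phic hu eps e0; have [d d0 hd] := phic _ e0; have [s hs] := hu _ d0.
by exists s => i /hs /hd.
Qed.

Lemma mulr_small (c : C) eps : 0 < eps ->
  exists2 d, 0 < d & forall x : C, absv x < d -> absv (c * x) < eps.
Proof.
move=> e0; have c1 : 0 < 1 + absv c by rewrite ltr_pwDl ?absv_ge0.
exists (eps / (1 + absv c)); first by rewrite divr_gt0.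
move=> x; rewrite ltr_pdivlMr // absvM => h; apply: le_lt_trans h.
by rewrite mulrC ler_wpM2l ?absv_ge0 // lerDr.
Qed.

Lemma is_sumZ I (u : I -> C) S c : is_sum u S -> is_sum (fun i => c * u i) (c * S).
Proof.
apply: (@is_sum_morph _ (fun x => c * x)); last exact: mulr_small.
by move=> x y; rewrite mulrBr.
Qed.

Lemma nullZ I (u : I -> C) c : null_family u -> null_family (fun i => c * u i).
Proof. by apply: (@null_morph _ (fun x => c * x)); exact: mulr_small. Qed.

Lemma is_sumN I (u : I -> C) S : is_sum u S -> is_sum (fun i => - u i) (- S).
Proof.
move=> /(@is_sumZ _ _ _ (-1)); rewrite mulN1r; apply: eq_is_sum => i.
by rewrite mulN1r.
Qed.

Lemma is_sumB I (u v : I -> C) S T : is_sum u S -> is_sum v T ->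
  is_sum (fun i => u i - v i) (S - T).
Proof. by move=> hS hT; apply: is_sumD => //; exact: is_sumN. Qed.

Lemma is_sum_fin I (u : I -> C) (s : seq I) :
  uniq s -> (forall i, i \notin s -> u i = 0) -> is_sum u (\sum_(i <- s) u i).
Proof.
move=> us u0 eps e0; exists s => t ut st.
have pe : perm_eq [seq i <- t | i \in s] s.
  apply: uniq_perm; rewrite ?filter_uniq // => i.
  by rewrite mem_filter; case: (boolP (i \in s)) => //= /st ->.
rewrite [X in _ - X](bigID (mem s)) /= -[X in _ - (X + _)]big_filter.
rewrite (perm_big _ pe) /=.
by rewrite [X in _ - (_ + X)]big1 ?addr0 ?subrr ?absv0 // => i /u0.
Qed.

Lemma null_fin I (u : I -> C) (s : seq I) :
  (forall i, i \notin s -> u i = 0) -> null_family u.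
Proof. by move=> u0 eps e0; exists s => i /u0 ->; rewrite absv0. Qed.

Lemma is_sum_single I (u : I -> C) k :
  (forall i, i != k -> u i = 0) -> is_sum u (u k).
Proof.
move=> h; have -> : u k = \sum_(i <- [:: k]) u i by rewrite big_seq1.
by apply: is_sum_fin => // i; rewrite inE => /h.
Qed.

Lemma is_sum0 I : is_sum (fun=> 0 : C) 0 (I := I).
Proof. by move=> eps e0; exists [::] => t _ _; rewrite big1 // subrr absv0. Qed.

Lemma is_sum_dominant I (u : I -> C) S k : is_sum u S ->
  (forall i, i != k -> absv (u i) < absv (u k)) -> absv S = absv (u k).
Proof.
move=> hS h; have [uk|uk] := eqVneq (u k) 0.
  have -> : S = 0; last by rewrite uk.
  apply: (is_sum_unique hS); rewrite -[0]uk; apply: is_sum_single => i /h.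
  by rewrite uk absv0 ltNge absv_ge0.
have hk : is_sum (fun i => if i == k then u k else 0) (u k).
  have := @is_sum_single _ (fun i => if i == k then u k else 0) k.
  by rewrite eqxx; apply=> i /negbTE ->.
have := is_sum_lt (is_sumB hS hk); move=> /(_ (absv (u k))) h1.
rewrite -[S](subrK (u k)) addrC; apply: absvD_eq; apply: h1.
  by rewrite absv_gt0.
move=> i; case: eqVneq => [->|ik]; first by rewrite subrr absv0 absv_gt0.
by rewrite subr0; exact: h.
Qed.

Lemma is_sum_reindex I J (phi : J -> I) (psi : I -> J) (u : I -> C) S :
  cancel phi psi -> cancel psi phi ->
  is_sum u S -> is_sum (fun j => u (phi j)) S.
Proof.
move=> pK qK hS eps e0; have [s hs] := hS _ e0.
exists (map psi s) => t ut st.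
rewrite -(big_map phi xpredT u); apply: hs.
  by rewrite map_inj_uniq //; exact: can_inj pK.
move=> i si; rewrite -[i]qK map_f //; apply: st; exact: map_f.
Qed.

Lemma null_reindex I J (phi : J -> I) (psi : I -> J) (u : I -> C) :
  cancel phi psi -> null_family u -> null_family (fun j => u (phi j)).
Proof.
move=> pK hu eps e0; have [s hs] := hu _ e0.
exists (map psi s) => j hj; apply: hs; apply: contra hj => hj.
by apply/mapP; exists (phi j).
Qed.

Lemma is_sum_fubini I J (w : I * J -> C) (r : I -> C) S :
  is_sum w S -> (forall i, is_sum (fun j => w (i, j)) (r i)) -> is_sum r S.
Proof.
move=> hS hr eps e0; have [s hs] := hS _ e0.
exists (map fst s) => t ut st.
have /choice[a ha] := fun i => hr i _ e0.
(* Row [i] is cut to a set that is good for its own sum and covers the part of [s] in that row.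
   Errors do not add up, so one [eps] serves all rows. *)
pose T i := undup (a i ++ [seq x.2 | x <- s & x.1 == i]).
pose TT := [seq (i, j) | i <- t, j <- T i].
have uTT : uniq TT.
  apply: allpairs_uniq_dep => //; first by move=> i _; exact: undup_uniq.
  by move=> [i j] [k l] _ _ /= [-> ->].
have sTT : {subset s <= TT}.
  move=> [i j] ij; apply/allpairsPdep; exists i, j; split => //.
    by apply: st; apply/mapP; exists (i, j).
  rewrite mem_undup mem_cat; apply/orP; right; apply/mapP; exists (i, j) => //.
  by rewrite mem_filter eqxx.
have h1 := hs _ uTT sTT; apply: (absv_dist_lt h1).
rewrite big_allpairs_dep /= -sumrB; apply: absv_sum_lt => // i _.
rewrite absvB; apply: ha; first exact: undup_uniq.
by move=> j aj; rewrite mem_undup mem_cat aj.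
Qed.

Lemma null_fubini I J (w : I * J -> C) (r : I -> C) :
  null_family w -> (forall i, is_sum (fun j => w (i, j)) (r i)) -> null_family r.
Proof.
move=> hw hr eps e0; have [s hs] := hw _ e0.
exists (map fst s) => i si; apply: (is_sum_lt (hr i)) => // j; apply: hs.
by apply: contra si => ij; apply/mapP; exists (i, j).
Qed.

(** The bound is an element of [C] rather than a real number, so that [frob] and series can be
    applied to it. *)
Lemma null_bounded I (u : I -> C) : null_family u ->
  exists Y : C, forall i, absv (u i) <= absv Y.
Proof.
move=> hu; have [s hs] := hu 1 ltr01.
suff [Y Y1 hY] : exists2 Y : C, 1 <= absv Y & forall i, i \in s -> absv (u i) <= absv Y.
  exists Y => i; have [/hY //|/hs /ltW h] := boolP (i \in s).
  exact: le_trans Y1.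
elim: s {hs} => [|i s [Y Y1 hY]]; first by exists 1; rewrite ?absv1.
have [h|/ltW h] := leP (absv (u i)) (absv Y).
  by exists Y => // j; rewrite inE => /predU1P[->|/hY].
exists (u i); first exact: le_trans h.
by move=> j; rewrite inE => /predU1P[->//|/hY /le_trans]; apply.
Qed.

Lemma null_nat (u : nat -> C) :
  null_family u <->
  forall eps, 0 < eps -> exists N, forall n, (N <= n)%N -> absv (u n) < eps.
Proof.
split=> hu eps /hu[].
  move=> s hs; exists (\max_(i <- s) i).+1 => n hn; apply: hs.
  by apply/negP => ns; move: hn; rewrite ltnNge (@leq_bigmax_seq _ s xpredT id n ns isT).
move=> N hN; exists (iota 0 N) => n; rewrite mem_iota add0n /= -leqNgt; exact: hN.
Qed.

Lemma is_sum_nat_cvg (u : nat -> C) S :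
  is_sum u S -> series u n @[n --> \oo] --> S.
Proof.
move=> hS; apply/cvgn_absvP => eps /hS[s hs].
exists (\max_(i <- s) i).+1 => n hn; rewrite seriesEnat; apply: hs.
  by rewrite iota_uniq.
move=> i si; rewrite mem_index_iota /=; apply: leq_ltn_trans hn.
exact: (@leq_bigmax_seq _ s xpredT id i si isT).
Qed.

End Summation.

(** * Integral powers of the Frobenius map *)

Section FrobeniusPower.
Variables (R : realType) (C : completeNonarchClosedFieldType R).

Record frobenius_power := FrobeniusPower {
  fpow :> nat ;
  fpow_gt1 : (1 < fpow)%N ;
  fpow_pchar : [pchar C].-nat fpow
}.

Variable q : frobenius_power.
Implicit Types (x y z : C) (n m : int) (k l : nat).

Lemma fpow_gt0 : (0 < q)%N.
Proof. exact: ltnW (fpow_gt1 q). Qed.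

Lemma expfpow_gt0 k : (0 < q ^ k)%N.
Proof. by rewrite expn_gt0 fpow_gt0. Qed.

Lemma exprD_fpow k x y : (x + y) ^+ (q ^ k) = x ^+ (q ^ k) + y ^+ (q ^ k).
Proof. by apply: exprDn_pchar; rewrite pnatX fpow_pchar. Qed.

Lemma expr_fpow_inj k : injective (fun x : C => x ^+ (q ^ k)).
Proof.
move=> x y /= xy; apply/eqP; rewrite -subr_eq0.
have := exprD_fpow k (x - y) y; rewrite subrK xy => /esym/eqP.
by rewrite -subr_eq0 addrK expf_eq0 => /andP[].
Qed.

Lemma expr_fpow_root k z : exists y, y ^+ (q ^ k) = z.
Proof.
have [y hy] := solve_monicpoly (fun i => if i == 0%N then z else 0) (expfpow_gt0 k).
exists y; rewrite hy; case: (q ^ k)%N (expfpow_gt0 k) => // N _.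
by rewrite big_ord_recl /= expr0 mulr1 big1 ?addr0 // => i _; rewrite mul0r.
Qed.

(** Writing n = l - k with natural numbers merges the two cases of [frob] into one polynomial
    equation. Together with uniqueness ([frob_uniq]), it reduces every law of [frob] to one of
    natural powers. *)
Lemma frob_expr n k l z : n + k%:Z = l%:Z ->
  frob q n z ^+ (q ^ k) = z ^+ (q ^ l).
Proof.
case: n => m /= hkl; first by rewrite -exprM -expnD; case: hkl => <-.
have kE : k = (m.+1 + l)%N.
  by apply/eqP; rewrite -eqz_nat PoszD -hkl NegzE addrA subrr add0r.
have : [set y | y ^+ (q ^ m.+1) = z] (xget 0 [set y | y ^+ (q ^ m.+1) = z]).
  by have [y hy] := expr_fpow_root m.+1 z; apply: (@xgetPex _ 0); exists y.
by rewrite /= kE expnD exprM => ->.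
Qed.

Lemma int_shift n : exists k l, n + k%:Z = l%:Z.
Proof.
case: n => m; first by exists 0%N, m; rewrite addr0.
by exists m.+1, 0%N; rewrite NegzE addNr.
Qed.

Lemma frob_uniq n k l y z :
  n + k%:Z = l%:Z -> y ^+ (q ^ k) = z ^+ (q ^ l) -> y = frob q n z.
Proof.
by move=> h e; apply: (@expr_fpow_inj k); rewrite /= (frob_expr _ h).
Qed.

Lemma frobz0 z : frob q 0 z = z.
Proof. by rewrite /frob /= expn0 expr1. Qed.

Lemma frobzD n m z : frob q (n + m) z = frob q n (frob q m z).
Proof.
have [k [l h]] := int_shift m; have [k' [l' h']] := int_shift n.
apply/esym/(@frob_uniq _ (k' + k) (l' + l)).
  by rewrite !PoszD -h -h' addrACA.
rewrite expnD exprM (frob_expr _ h') -exprM mulnC exprM (frob_expr _ h) -exprM.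
by rewrite mulnC -expnD.
Qed.

Lemma frobD n : {morph @frob R C q n : x y / x + y}.
Proof.
move=> x y; have [k [l h]] := int_shift n; apply/esym/(frob_uniq h).
by rewrite !exprD_fpow !(frob_expr _ h).
Qed.

Lemma frobM n : {morph @frob R C q n : x y / x * y}.
Proof.
move=> x y; have [k [l h]] := int_shift n; apply/esym/(frob_uniq h).
by rewrite !exprMn !(frob_expr _ h).
Qed.

Lemma frob0 n : frob q n 0 = 0 :> C.
Proof. by apply: (@addIr C (frob q n 0)); rewrite -frobD !add0r. Qed.

Lemma frobN n : {morph @frob R C q n : x / - x}.
Proof. by move=> x; apply: (@addIr _ (frob q n x)); rewrite -frobD !addNr frob0. Qed.

Lemma frobB n : {morph @frob R C q n : x y / x - y}.
Proof. by move=> x y; rewrite frobD frobN. Qed.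

Lemma frobK n : cancel (@frob R C q n) (frob q (- n)).
Proof. by move=> z; rewrite -frobzD addNr frobz0. Qed.

Lemma frobKV n : cancel (@frob R C q (- n)) (frob q n).
Proof. by move=> z; rewrite -frobzD addrN frobz0. Qed.

Lemma frob_eq0 n z : (frob q n z == 0) = (z == 0).
Proof.
by apply/eqP/eqP => [h|->]; [rewrite -(frobK n z) h|]; rewrite frob0.
Qed.

Lemma frob1 n : frob q n 1 = 1 :> C.
Proof.
have n0 : frob q n 1 != 0 :> C by rewrite frob_eq0 oner_neq0.
by apply: (mulfI n0); rewrite -frobM !mulr1.
Qed.

Lemma frobV n : {morph @frob R C q n : x / x^-1}.
Proof.
move=> x; have [->|x0] := eqVneq x 0; first by rewrite invr0 frob0 invr0.
have n0 : frob q n x != 0 by rewrite frob_eq0.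
by apply: (mulfI n0); rewrite -frobM !divff // frob1.
Qed.

Lemma frob_Fq n (c : C) : Fq q c -> frob q n c = c.
Proof.
rewrite /Fq /= => cq; have nat_case k : c ^+ (q ^ k) = c.
  by elim: k => [|k IH]; rewrite ?expr1 // expnS exprM cq.
have [k [l h]] := int_shift n; apply/esym/(frob_uniq h).
by rewrite !nat_case.
Qed.

Lemma absv_frob_expr n k l z : n + k%:Z = l%:Z ->
  absv (frob q n z) ^+ (q ^ k) = absv z ^+ (q ^ l).
Proof. by move=> h; rewrite -!absvX (frob_expr _ h). Qed.

Lemma absv_frob_le n x y :
  (absv (frob q n x) <= absv (frob q n y)) = (absv x <= absv y).
Proof.
have [k [l h]] := int_shift n.
rewrite -(@ler_pXn2r _ (q ^ k)) ?expfpow_gt0 ?nnegrE ?absv_ge0 //.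
by rewrite !(absv_frob_expr _ h) ler_pXn2r ?expfpow_gt0 ?nnegrE ?absv_ge0.
Qed.

Lemma absv_frob_lt n x y :
  (absv (frob q n x) < absv (frob q n y)) = (absv x < absv y).
Proof. by rewrite !ltNge absv_frob_le. Qed.

Lemma absv_frob_eq n x y : absv x = absv y -> absv (frob q n x) = absv (frob q n y).
Proof. by move=> h; apply/eqP; rewrite eq_le !absv_frob_le h lexx. Qed.

Lemma absv_frob_le1 n x : (absv (frob q n x) <= 1) = (absv x <= 1).
Proof. by have := absv_frob_le n x 1; rewrite frob1 absv1. Qed.

Lemma absv_frob_lt1 n x : (absv (frob q n x) < 1) = (absv x < 1).
Proof. by have := absv_frob_lt n x 1; rewrite frob1 absv1. Qed.

Lemma frob_small n (eps : R) : 0 < eps ->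
  exists2 d, 0 < d & forall x, absv x < d -> absv (frob q n x) < eps.
Proof.
move=> e0; have [k [l h]] := int_shift n.
pose d := Num.min 1 (eps ^+ (q ^ k)).
exists d; first by rewrite lt_min ltr01 exprn_gt0.
move=> x; rewrite lt_min => /andP[x1 xe].
rewrite -(@ltr_pXn2r _ (q ^ k)) ?expfpow_gt0 ?nnegrE ?absv_ge0 ?(ltW e0) //.
rewrite (absv_frob_expr _ h); apply: le_lt_trans xe.
by rewrite -[leRHS]expr1 ler_wiXn2l ?absv_ge0 ?(ltW x1) ?expfpow_gt0.
Qed.

Lemma absv_frob_mono m n z : 1 <= absv z -> m <= n ->
  absv (frob q m z) <= absv (frob q n z).
Proof.
move=> z1 mn; rewrite -(subrKC m n) frobzD absv_frob_le.
have : 0 <= n - m by rewrite subr_ge0.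
case: (n - m) => // k _; rewrite /= absvX -[leLHS]expr1.
by rewrite ler_weXn2l ?expfpow_gt0.
Qed.

Lemma absv_frob_mono_lt m n z : 1 < absv z -> m < n ->
  absv (frob q m z) < absv (frob q n z).
Proof.
move=> z1 mn; rewrite -(subrKC m n) frobzD absv_frob_lt.
have : 0 < n - m by rewrite subr_gt0.
case: (n - m) => // -[//|k] _; rewrite /= absvX -[ltLHS]expr1.
by rewrite ltr_eXn2l // -[X in (X < _)%N](expn0 q) ltn_exp2l ?fpow_gt1.
Qed.

Lemma absv_frob_anti m n z : absv z <= 1 -> m <= n ->
  absv (frob q n z) <= absv (frob q m z).
Proof.
move=> z1 mn; rewrite -(subrKC m n) frobzD absv_frob_le.
have : 0 <= n - m by rewrite subr_ge0.
case: (n - m) => // k _; rewrite /= absvX -[leRHS]expr1.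
by rewrite ler_wiXn2l ?absv_ge0 ?expfpow_gt0.
Qed.

Lemma absv_frob_inj m n z : z != 0 -> absv z != 1 ->
  absv (frob q m z) = absv (frob q n z) -> m = n.
Proof.
wlog z1 : z / 1 < absv z.
  move=> wl z0 z1 h.
  have [lt1|gt1|/eqP] := ltgtP (absv z) 1; last by rewrite (negbTE z1).
    apply: (wl z^-1); rewrite ?invr_eq0 //.
    - by rewrite absvV invf_gt1 ?absv_gt0.
    - by rewrite absvV invr_eq1.
    - by rewrite !frobV !absvV h.
  exact: (wl z).
move=> _ _ h; have [mn|nm|//] := ltgtP m n.
  by have := absv_frob_mono_lt z1 mn; rewrite h ltxx.
by have := absv_frob_mono_lt z1 nm; rewrite h ltxx.
Qed.

Lemma is_sum_frob (I : eqType) n (u : I -> C) S :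
  is_sum u S -> is_sum (fun i => frob q n (u i)) (frob q n S).
Proof. by apply: is_sum_morph; [exact: frobB | exact: frob_small]. Qed.

Lemma null_frob (I : eqType) n (u : I -> C) :
  null_family u -> null_family (fun i => frob q n (u i)).
Proof. by apply: null_morph; exact: frob_small. Qed.

End FrobeniusPower.

(** * Two-sided series as unordered sums *)

Section IntegerSums.
Variables (R : realType) (C : completeNonarchClosedFieldType R).
Implicit Types (u : int -> C) (eps : R).

Lemma null_int u :
  null_family u <->
  forall eps, 0 < eps -> exists N : nat,
    forall n : int, (N < `|n|)%N -> absv (u n) < eps.
Proof.
split=> hu eps /hu[].
  move=> s hs; exists (\max_(i <- s) `|i|%N) => n hn; apply: hs.
  apply/negP => ns; move: hn; rewrite ltnNge.
  by rewrite (@leq_bigmax_seq _ s xpredT (fun i : int => `|i|%N) n ns isT).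
move=> N hN; exists (map Posz (iota 0 N.+1) ++ map Negz (iota 0 N)) => n.
rewrite mem_cat negb_or => /andP[h1 h2]; apply: hN; rewrite ltnNge; apply/negP.
case: n h1 h2 => k h1 h2 kN.
  by move: h1; rewrite map_f // mem_iota add0n ltnS.
by move: h2; rewrite map_f // mem_iota add0n.
Qed.

Lemma cvg_series_null (v : nat -> C) : cvgn (series v) ->
  forall eps, 0 < eps -> exists N, forall n, (N <= n)%N -> absv (v n) < eps.
Proof.
move=> /cvg_ex[l /cvgn_absvP hl] eps e0; have [N hN] := hl _ e0.
exists N => n Nn; have -> : v n = series v n.+1 - series v n.
  by rewrite /series /= big_nat_recr //= addrAC subrr add0r.
apply: (@absv_dist_lt _ _ l); last exact: hN.
by rewrite absvB; apply: hN; exact: leq_trans (leqnSn n).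
Qed.

Lemma zsummable_null u : zsummable u <-> null_family u.
Proof.
split.
  move=> [/cvg_series_null h1 /cvg_series_null h2]; apply/null_int => eps e0.
  have [N hN] := h1 _ e0; have [M hM] := h2 _ e0.
  exists (maxn N M) => -[k|k] /=; rewrite gtn_max => /andP[a b].
    by apply: hN; exact: ltnW.
  by apply: hM; rewrite -ltnS.
move=> hu; split.
  have hu1 : null_family (u \o Posz).
    move=> eps e0; have [N hN] := (null_int u).1 hu _ e0.
    exists (iota 0 N.+1) => n; rewrite mem_iota add0n /= -leqNgt; exact: (hN (Posz n)).
  by have [S /is_sum_nat_cvg/cvgP] := is_sum_ex hu1.
have hu1 : null_family (u \o Negz).
  move=> eps e0; have [N hN] := (null_int u).1 hu _ e0.
  exists (iota 0 N.+1) => n; rewrite mem_iota add0n /= -leqNgt => Nn.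
  by apply: hN => /=; exact: ltnW.
by have [S /is_sum_nat_cvg/cvgP] := is_sum_ex hu1.
Qed.

Lemma zsumP u : null_family u -> is_sum u (zsum u).
Proof.
move=> hu; have [S hS] := is_sum_ex hu.
have [c1 c2] := (zsummable_null u).2 hu.
suff -> : zsum u = S by [].
apply/eqP; rewrite -subr_eq0; apply/eqP/absv_small_eq0 => eps e0.
have [s hs] := hS _ e0.
have [N1 h1] := (cvgn_absvP _ _).1 c1 _ e0.
have [N2 h2] := (cvgn_absvP _ _).1 c2 _ e0.
pose n := maxn (\max_(i <- s) `|i|%N).+1 (maxn N1 N2).
have := hs (map Posz (iota 0 n) ++ map Negz (iota 0 n)).
rewrite cat_uniq !map_inj_uniq ?iota_uniq /=; last 2 first.
- by move=> a b [].
- by move=> a b [].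
have -> : has (mem [seq Posz i | i <- iota 0 n]) [seq Negz i | i <- iota 0 n] = false.
  by apply/negbTE/hasPn => _ /mapP[i _ ->]; apply/negP => /mapP[].
move=> /(_ isT) hsn.
have sub : {subset s <= map Posz (iota 0 n) ++ map Negz (iota 0 n)}.
  move=> i si; have : (`|i| < n)%N.
    rewrite leq_max; apply/orP; left; rewrite ltnS.
    by rewrite (@leq_bigmax_seq _ s xpredT (fun i : int => `|i|%N) i si isT).
  rewrite mem_cat; case: i si => k _ /= kn; first by rewrite map_f // mem_iota add0n.
  by rewrite (@map_f _ _ Negz) ?orbT // mem_iota add0n /= ltnW.
have {hsn sub} := hsn sub; rewrite big_cat !big_map /= => hsn.
rewrite absvB; apply: (absv_dist_lt hsn).
rewrite /zsum opprD addrACA.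
have n1 : (N1 <= n)%N by rewrite !leq_max leqnn orbT.
have n2 : (N2 <= n)%N by rewrite !leq_max leqnn !orbT.
have := h1 _ n1; have := h2 _ n2; rewrite !seriesEnat /index_iota !subn0 /= => a b.
by apply: absvD_lt; rewrite absvB.
Qed.

Lemma zsum_eq u S : is_sum u S -> null_family u -> zsum u = S.
Proof. by move=> hS hu; apply: is_sum_unique hS; exact: zsumP. Qed.

(** Among the indices of maximal absolute value the last is taken. Strictness to its right is what
    lets dominant indices add up under composition. *)
Lemma null_int_max u : null_family u -> (exists n, u n != 0) ->
  exists k : int, [/\ u k != 0, forall i, absv (u i) <= absv (u k)
    & forall i, k < i -> absv (u i) < absv (u k)].
Proof.
move=> /null_int hu [m um]; have [N hN] := hu (absv (u m)) ltac:(by rewrite absv_gt0).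
pose P (i : 'I_(N + N).+1) := u (i%:Z - N%:Z).
have inP (i : int) : (`|i| <= N)%N -> exists j, P j = u i.
  move=> iN; have h0 : 0 <= i + N%:Z by lia.
  have hb : (`|(i + N%:Z)%R| < (N + N).+1)%N by lia.
  by exists (Ordinal hb); rewrite /P /= gez0_abs // addrK.
have mN : (`|m| <= N)%N by rewrite leqNgt; apply/negP => /hN; rewrite ltxx.
have [j0 hj0] := inP _ mN.
have [j1 hj1] : exists j1, forall j, absv (P j) <= absv (P j1).
  have := @arg_maxP _ _ _ j0 xpredT (fun j => absv (P j)) isT.
  by case=> j _ hj; exists j => i; exact: hj.
pose Q (j : 'I_(N + N).+1) := absv (P j) == absv (P j1).
have Q1 : Q j1 by rewrite /Q.
case: (@arg_maxnP _ j1 Q (fun j => nat_of_ord j) Q1) => j2 /eqP Qj2 hj2.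
have big i : absv (u i) <= absv (P j2).
  rewrite Qj2; have [/inP[j <-] //|/hN/ltW h] := leqP `|i|%N N.
  by apply: (le_trans h); rewrite -hj0.
exists (j2%:Z - N%:Z); rewrite -/(P j2); split => //.
  rewrite -absv_gt0; apply: lt_le_trans (big m); by rewrite absv_gt0.
move=> i hi; rewrite lt_neqAle big andbT; apply/negP => /eqP ei.
have [iN|/hN h] := leqP `|i|%N N; last first.
  by have := le_lt_trans (big m) (le_lt_trans _ h); rewrite -ei lexx ltxx => /(_ isT).
have [j hj] := inP _ iN.
have h0 : 0 <= i + N%:Z by lia.
have hb : (`|(i + N%:Z)%R| < (N + N).+1)%N by lia.
have := hj2 (Ordinal hb); rewrite /Q /P /= gez0_abs // addrK ei -Qj2 eqxx => /(_ isT).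
lia.
Qed.

End IntegerSums.

(** * Evaluation, composition and adjoint of entire series *)

Section Operators.
Variables (R : realType) (C : completeNonarchClosedFieldType R).
Variable q : frobenius_power C.
Implicit Types (a b f g h : int -> C) (x y z w c : C) (n m i : int) (eps : R).

Lemma entireP f :
  entire q f <-> forall z, null_family (fun n => f n * frob q n z).
Proof. by split=> h z; apply/zsummable_null; exact: h. Qed.

Lemma entire_null f z : entire q f -> null_family (fun n => f n * frob q n z).
Proof. by move=> /entireP. Qed.

Lemma entire_coef_null f : entire q f -> null_family f.
Proof. by move=> /(entire_null 1); apply: eq_null => n; rewrite frob1 mulr1. Qed.

Lemma evalTP f z : entire q f -> is_sum (fun n => f n * frob q n z) (evalT q f z).
Proof. by move=> hf; apply: zsumP; exact: entire_null. Qed.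

Lemma evalT_eq f z S : entire q f -> is_sum (fun n => f n * frob q n z) S ->
  evalT q f z = S.
Proof. by move=> hf; apply: is_sum_unique; exact: evalTP. Qed.

Lemma evalT_lt f z eps : entire q f -> 0 < eps ->
  (forall n, absv (f n * frob q n z) < eps) -> absv (evalT q f z) < eps.
Proof. by move=> hf; apply: is_sum_lt; exact: evalTP. Qed.

Lemma evalTB f x y : entire q f -> evalT q f (x - y) = evalT q f x - evalT q f y.
Proof.
move=> hf; apply: evalT_eq => //.
have := is_sumB (evalTP x hf) (evalTP y hf).
by apply: eq_is_sum => n; rewrite frobB mulrBr.
Qed.

Lemma evalT0 f : entire q f -> evalT q f 0 = 0.
Proof. by move=> hf; have := evalTB 0 0 hf; rewrite !subrr. Qed.

Lemma evalTD f x y : entire q f -> evalT q f (x + y) = evalT q f x + evalT q f y.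
Proof.
move=> hf; have := evalTB 0 y hf; rewrite evalT0 // !sub0r => hN.
by rewrite -[y in LHS]opprK evalTB // hN opprK.
Qed.

Lemma evalT_Fq f c x : entire q f -> Fq q c -> evalT q f (c * x) = c * evalT q f x.
Proof.
move=> hf hc; apply: evalT_eq => //.
have := is_sumZ c (evalTP x hf); apply: eq_is_sum => n.
by rewrite frobM (frob_Fq _ hc) mulrCA.
Qed.

Lemma entireB f g : entire q f -> entire q g -> entire q (fun n => f n - g n).
Proof.
move=> hf hg; apply/entireP => z.
have := nullB (entire_null z hf) (entire_null z hg).
by apply: eq_null => n; rewrite mulrBl.
Qed.

Lemma evalT_subl f g z : entire q f -> entire q g ->
  evalT q (fun n => f n - g n) z = evalT q f z - evalT q g z.
Proof.
move=> hf hg; apply: evalT_eq; first exact: entireB.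
have := is_sumB (evalTP z hf) (evalTP z hg).
by apply: eq_is_sum => n; rewrite mulrBl.
Qed.

(** A bound [Y] of the family [y] makes the terms small uniformly in [j] for all but finitely many
    [i]; each remaining [i] is settled by continuity of [frob]. *)
Lemma null_comp (J : eqType) a (y : J -> C) : entire q a -> null_family y ->
  null_family (fun ij : int * J => a ij.1 * frob q ij.1 (y ij.2)).
Proof.
move=> ha hy eps e0; have [Y hY] := null_bounded hy.
have [s hs] := entire_null Y ha e0.
have /choice[T hT] : forall i, exists T : seq J,
    forall j, j \notin T -> absv (a i * frob q i (y j)) < eps.
  by move=> i; exact: (nullZ (a i) (null_frob q i hy) e0).
exists [seq (i, j) | i <- s, j <- T i] => -[i j] /= ij.
have [si|si] := boolP (i \in s).
  apply: hT; apply: contra ij => Tj; apply/allpairsPdep.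
  by exists i, j.
apply: le_lt_trans (hs _ si); rewrite !absvM ler_wpM2l ?absv_ge0 //.
by rewrite absv_frob_le.
Qed.

Lemma comp_is_sum (J : eqType) a (y : J -> C) Y : entire q a -> null_family y ->
  is_sum y Y ->
  is_sum (fun ij : int * J => a ij.1 * frob q ij.1 (y ij.2)) (evalT q a Y).
Proof.
move=> ha hy hY; have [S hS] := is_sum_ex (null_comp ha hy).
suff -> : evalT q a Y = S by [].
apply: evalT_eq => //; apply: (is_sum_fubini hS) => i /=.
by apply: is_sumZ; exact: is_sum_frob.
Qed.

Lemma evalT_is_sum (J : eqType) a (y : J -> C) Y : entire q a -> null_family y ->
  is_sum y Y -> is_sum (fun j => evalT q a (y j)) (evalT q a Y).
Proof.
move=> ha hy hY; have hS := comp_is_sum ha hy hY.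
pose sw (K L : Type) (x : K * L) := (x.2, x.1).
have := @is_sum_reindex _ _ _ _ (@sw J int) (@sw int J) _ _ _ _ hS.
move=> /(_ _ _)/is_sum_fubini; apply; try by case.
by move=> j /=; exact: evalTP.
Qed.

Lemma compT_is_sum a b n : entire q a -> null_family b ->
  is_sum (fun i => a i * frob q i (b (n - i))) (compT q a b n).
Proof.
move=> ha hb; apply: zsumP; have [Y hY] := null_bounded hb.
apply: null_le (entire_null Y ha) => i.
by rewrite !absvM ler_wpM2l ?absv_ge0 // absv_frob_le.
Qed.

(** One double series is summed in two ways: by rows it gives the value of [a] at the value of [b],
    along the diagonals i + j = n it gives the composed series. *)
Lemma compT_eval a b z : entire q a -> entire q b ->
  null_family (fun n => compT q a b n * frob q n z) /\
  is_sum (fun n => compT q a b n * frob q n z) (evalT q a (evalT q b z)).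
Proof.
move=> ha hb; pose y j := b j * frob q j z.
have hy : null_family y by exact: entire_null.
pose phi (x : int * int) := (x.2, x.1 - x.2).
pose psi (x : int * int) := (x.1 + x.2, x.1).
have pK : cancel phi psi by move=> [n i]; rewrite /phi /psi /= subrKC.
have qK : cancel psi phi by move=> [i j]; rewrite /phi /psi /= addrAC subrr add0r.
have rows n : is_sum (fun i => let ij := phi (n, i) in
    a ij.1 * frob q ij.1 (y ij.2)) (compT q a b n * frob q n z).
  rewrite mulrC; have := is_sumZ (frob q n z) (compT_is_sum n ha (entire_coef_null hb)).
  apply: eq_is_sum => i /=; rewrite /y frobM -frobzD subrKC.
  by rewrite mulrC mulrA.
split.
  exact: null_fubini (null_reindex pK (null_comp ha hy)) rows.
exact: is_sum_fubini (is_sum_reindex pK qK (comp_is_sum ha hy (evalTP z hb))) rows.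
Qed.

Lemma entire_comp a b : entire q a -> entire q b -> entire q (compT q a b).
Proof. by move=> ha hb; apply/entireP => z; have [] := compT_eval z ha hb. Qed.

Lemma evalT_comp a b z : entire q a -> entire q b ->
  evalT q (compT q a b) z = evalT q a (evalT q b z).
Proof.
by move=> ha hb; apply: evalT_eq; [exact: entire_comp | exact: (compT_eval z ha hb).2].
Qed.

(** For n >= 0, raising |f_(-n) z| < 1 to the power q^n only shrinks it. For n = -m < 0 the roots
    |f_m|^(1/q^m) must tend to 0: convergence at u^-1 gives |f_m| < |u|^(q^m) for large m, however
    small [u] is. *)
Lemma entire_adj f : entire q f -> entire q (adjT q f).
Proof.
move=> hf; apply/entireP => z; apply/null_int => eps e0.
pose B := 1 + absv z.
have B1 : 1 <= B by rewrite lerDl absv_ge0.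
have B0 : 0 < B by exact: lt_le_trans B1.
have [N1 hN1] : exists N : nat, forall n : int, (N < `|n|)%N -> 0 <= n ->
    absv (frob q n (f (- n)) * frob q n z) < eps.
  have d0 : 0 < Num.min 1 eps / B by rewrite divr_gt0 // lt_min ltr01.
  have [N hN] := (null_int _).1 (entire_coef_null hf) _ d0.
  exists N => n Nn n0; rewrite -frobM.
  have : absv (f (- n) * z) < Num.min 1 eps.
    rewrite absvM; apply: le_lt_trans (_ : absv (f (- n)) * B < _).
      by rewrite ler_wpM2l ?absv_ge0 // lerDr.
    by rewrite -ltr_pdivlMr //; apply: hN; rewrite abszN.
  rewrite lt_min => /andP[h1 h2]; apply: le_lt_trans h2.
  have := @absv_frob_anti _ _ q 0 n (f (- n) * z) (ltW h1) n0.
  by rewrite frobz0.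
have [N2 hN2] : exists N : nat, forall n : int, (N < `|n|)%N -> n <= 0 ->
    absv (frob q n (f (- n)) * frob q n z) < eps.
  have d0 : 0 < eps / B by rewrite divr_gt0.
  suff [N hN] : exists N : nat, forall n : int, (N < `|n|)%N ->
      absv (frob q n (f (- n))) < eps / B.
    exists N => n Nn n0; rewrite absvM.
    apply: le_lt_trans (_ : absv (frob q n (f (- n))) * B < _); last first.
      by rewrite -ltr_pdivlMr //; exact: hN.
    rewrite ler_wpM2l ?absv_ge0 //; have [z1|z1] := leP 1 (absv z).
      have := @absv_frob_mono _ _ q n 0 z z1 n0; rewrite frobz0 => /le_trans; apply.
      by rewrite lerDr.
    apply: le_trans B1; by rewrite absv_frob_le1 ltW.
  have [[u u0 ue]|none] := pselect (exists2 u : C, u != 0 & absv u < eps / B).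
    have [N hN] := (null_int _).1 (entire_null u^-1 hf) _ ltr01.
    exists N => n Nn; apply: lt_trans ue; rewrite -(absv_frob_lt q (- n)) frobK.
    have := hN (- n); rewrite abszN => /(_ Nn).
    by rewrite frobV absvM absvV ltr_pdivrMr ?mul1r // absv_gt0 frob_eq0.
  have [N hN] := (null_int _).1 (entire_coef_null hf) _ d0.
  exists N => n Nn; suff -> : f (- n) = 0 by rewrite frob0 absv0.
  apply/eqP; apply: contraT => fn; case: none; exists (f (- n)) => //.
  by apply: hN; rewrite abszN.
exists (maxn N1 N2) => n; rewrite gtn_max => /andP[n1 n2].
rewrite /adjT; have [n0|n0] := leP 0 n; first exact: hN1.
by apply: hN2 => //; exact: ltW.
Qed.

Lemma adjTK f : adjT q (adjT q f) = f.
Proof. by apply/funext => n; rewrite /adjT opprK frobKV. Qed.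

Lemma adjT_comp a b : entire q a -> entire q b ->
  adjT q (compT q a b) = compT q (adjT q b) (adjT q a).
Proof.
move=> ha hb; apply/funext => n; rewrite /adjT.
have h1 := is_sum_frob q n (compT_is_sum (- n) ha (entire_coef_null hb)).
have h2 := compT_is_sum n (entire_adj hb) (entire_coef_null (entire_adj ha)).
apply: is_sum_unique h2.
have := @is_sum_reindex _ _ _ _ (fun j => j - n) (fun i => i + n) _ _ _ _ h1.
move=> /(_ (subrK n) (addrK n)); apply: eq_is_sum => j.
rewrite /adjT; have -> : - n - (j - n) = - j by lia.
have -> : - (n - j) = j - n by lia.
by rewrite frobM -!frobzD mulrC !subrKC.
Qed.

Definition monoT c m : int -> C := fun n => if n == m then c else 0.

Lemma constTE c : constT c = monoT c 0. Proof. by []. Qed.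

Lemma compT_monol c m f n : compT q (monoT c m) f n = c * frob q m (f (n - m)).
Proof.
have h0 i : i != m -> monoT c m i * frob q i (f (n - i)) = 0.
  by rewrite /monoT => /negbTE ->; rewrite mul0r.
have -> : c * frob q m (f (n - m)) = monoT c m m * frob q m (f (n - m)).
  by rewrite /monoT eqxx.
rewrite /compT; apply: zsum_eq; first exact: (is_sum_single h0).
by apply: (@null_fin _ _ _ _ [:: m]) => i; rewrite inE; exact: h0.
Qed.

Lemma compT_monor c m f n : compT q f (monoT c m) n = f (n - m) * frob q (n - m) c.
Proof.
have h0 i : i != n - m -> f i * frob q i (monoT c m (n - i)) = 0.
  move=> im; rewrite /monoT; case: eqP => [e|_]; last by rewrite frob0 mulr0.
  by move: im; rewrite -e opprB addrC subrK eqxx.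
have -> : f (n - m) * frob q (n - m) c =
    f (n - m) * frob q (n - m) (monoT c m (n - (n - m))).
  by rewrite /monoT subKr eqxx.
rewrite /compT; apply: zsum_eq; first exact: (is_sum_single h0).
by apply: (@null_fin _ _ _ _ [:: n - m]) => i; rewrite inE; exact: h0.
Qed.

Lemma mono_is_sum c m z :
  is_sum (fun n => monoT c m n * frob q n z) (c * frob q m z).
Proof.
have h0 i : i != m -> monoT c m i * frob q i z = 0.
  by rewrite /monoT => /negbTE ->; rewrite mul0r.
have -> : c * frob q m z = monoT c m m * frob q m z by rewrite /monoT eqxx.
exact: (is_sum_single h0).
Qed.

Lemma entire_mono c m : entire q (monoT c m).
Proof.
apply/entireP => z; apply: (@null_fin _ _ _ _ [:: m]) => i.
by rewrite inE /monoT => /negbTE ->; rewrite mul0r.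
Qed.

Lemma evalT_mono c m z : evalT q (monoT c m) z = c * frob q m z.
Proof. by apply: evalT_eq; [exact: entire_mono | exact: mono_is_sum]. Qed.

Lemma evalT_const c z : evalT q (constT c) z = c * z.
Proof. by rewrite constTE evalT_mono frobz0. Qed.

Lemma adjT_mono c m : adjT q (monoT c m) = monoT (frob q (- m) c) (- m).
Proof.
apply/funext => n; rewrite /adjT /monoT eqr_oppLR.
by case: eqP => [->//|_]; rewrite frob0.
Qed.

Lemma adjT_const c : adjT q (constT c) = constT c.
Proof. by rewrite constTE adjT_mono oppr0 frobz0. Qed.

Lemma entire_one_sub_tau : entire q (@one_sub_tau R C).
Proof. exact: entireB (entire_mono 1 0) (entire_mono 1 1). Qed.

Lemma evalT_one_sub_tau z : evalT q (@one_sub_tau R C) z = z - z ^+ q.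
Proof.
rewrite (evalT_subl _ (entire_mono 1 0) (entire_mono 1 1)) !evalT_mono.
by rewrite frobz0 !mul1r /frob /= expn1.
Qed.

(** Each term is bounded, and not only the sum: it is the bound on terms that passes to the
    normalised factors of a series ([normalT_comp_bound]). *)
Lemma evalT_small f eps : entire q f -> 0 < eps ->
  exists2 d, 0 < d & forall x, absv x < d -> forall n, absv (f n * frob q n x) < eps.
Proof.
move=> hf e0; have [s hs] := entire_coef_null hf e0.
have [d d0 hd] : exists2 d, 0 < d & forall x, absv x < d ->
    forall n, n \in s -> absv (f n * frob q n x) < eps.
  elim: s {hs} => [|n s [d d0 hd]]; first by exists 1.
  have [d1 d10 hd1] := mulr_small (f n) e0.
  have [d2 d20 hd2] := frob_small q n d10.
  exists (Num.min d d2); first by rewrite lt_min d0.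
  move=> x; rewrite lt_min => /andP[xd xd2] m; rewrite inE => /predU1P[->|ms].
    by apply: hd1; exact: hd2.
  exact: hd.
exists (Num.min 1 d); first by rewrite lt_min ltr01.
move=> x; rewrite lt_min => /andP[x1 xd] n; have [ns|ns] := boolP (n \in s).
  exact: hd.
apply: le_lt_trans (hs _ ns); rewrite absvM ler_piMr ?absv_ge0 //.
by rewrite absv_frob_le1 ltW.
Qed.

End Operators.

(** * Controlled surjectivity, and injectivity of evaluation *)

Section Surjectivity.
Variables (R : realType) (C : completeNonarchClosedFieldType R).
Variable q : frobenius_power C.
Implicit Types (f g : int -> C) (x y z w : C) (n m : int) (eps : R).

(** Multiplication by X - x with |x| > rho keeps the constant term strictly dominant on the disc of
    radius rho. Read backwards, a term that matches the constant one forces a root in that disc. *)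
Lemma prod_XsubC_coef_lt (r : seq C) (rho : R) : 0 < rho ->
  all (fun x => rho < absv x) r ->
  let S := \prod_(x <- r) ('X - x%:P) in
  0 < absv S`_0 /\ forall j, (0 < j)%N -> absv S`_j * rho ^+ j < absv S`_0.
Proof.
move=> r0; elim: r => [_|x r IH /= /andP[rx /IH]].
  rewrite big_nil /= coef1 eqxx absv1; split=> // j j0.
  by rewrite coef1 gtn_eqF // absv0 mul0r.
rewrite big_cons; set S := \prod_(_ <- r) _ => -[S0 hS].
have x0 : 0 < absv x by exact: lt_trans rx.
have e0 : (('X - x%:P) * S)`_0 = - (x * S`_0).
  by rewrite mulrBl coefB coefXM coefCM sub0r.
rewrite /= e0 absvN absvM; split; first by rewrite mulr_gt0.
case=> // j _; rewrite mulrBl coefB coefXM coefCM /=.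
rewrite -[rho ^+ j.+1]gtr0_norm ?exprn_gt0 //.
rewrite -ltr_pdivlMr ?normr_gt0 ?gt_eqF ?exprn_gt0 // gtr0_norm ?exprn_gt0 //.
apply: absvB_lt; rewrite ltr_pdivlMr ?exprn_gt0 //; last first.
  by rewrite absvM -mulrA ltr_pM2l // hS.
rewrite exprS mulrCA mulrC.
apply: (@le_lt_trans _ _ (absv S`_0 * rho)).
  rewrite ler_pM2r //; case: j => [|j]; first by rewrite expr0 mulr1.
  exact/ltW/hS.
by rewrite mulrC ltr_pM2r.
Qed.

Lemma poly_root_le (P : {poly C}) (rho : R) j : 0 < rho -> (0 < j)%N ->
  absv P`_0 <= absv P`_j * rho ^+ j -> exists2 x, root P x & absv x <= rho.
Proof.
move=> r0 j0 h; have [P0|P0] := eqVneq P 0.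
  by exists 0; rewrite ?P0 ?root0 // absv0 ltW.
have [r Pr] := closed_field_poly_normal P.
have [/hasP[x xr xrho]|] := boolP (has (fun x => absv x <= rho) r).
  by exists x => //; rewrite Pr rootZ ?lead_coef_eq0 // root_prod_XsubC.
rewrite -all_predC => hall.
have hall' : all (fun x => rho < absv x) r.
  by apply: sub_all hall => x /=; rewrite -ltNge.
have [_ /(_ _ j0)] := prod_XsubC_coef_lt r0 hall'.
have l0 : 0 < absv (lead_coef P) by rewrite absv_gt0 lead_coef_eq0.
rewrite -(ltr_pM2l l0) mulrA -!absvM -!coefZ -Pr => hlt.
by have := le_lt_trans h hlt; rewrite ltxx.
Qed.

Definition truncT f (N : nat) : int -> C :=
  fun n => if (`|n| <= N)%N then f n else 0.

(** This is [tau ^ N] composed with the truncation: the exponents become natural, and since [frob]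
    is bijective neither zeros nor solvability change. *)
Definition truncP f (N : nat) : {poly C} :=
  \sum_(j < (N + N).+1) frob q N%:Z (f (j%:Z - N%:Z)) *: 'X^(q ^ j).

Let win (N : nat) : seq int := [seq j%:Z - N%:Z | j <- index_iota 0 (N + N).+1].

Let truncT_win f N n : n \notin win N -> truncT f N n = 0.
Proof.
rewrite /truncT; case: ifP => // nN /negP[]; apply/mapP.
exists (absz (n + N%:Z)); first by rewrite mem_index_iota; lia.
rewrite gez0_abs ?addrK //; lia.
Qed.

Lemma entire_trunc f N : entire q (truncT f N).
Proof.
apply/entireP => z; apply: (@null_fin _ _ _ _ (win N)) => n /truncT_win ->.
by rewrite mul0r.
Qed.

Lemma horner_truncP f N z : (truncP f N).[z] = frob q N%:Z (evalT q (truncT f N) z).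
Proof.
have uw : uniq (win N).
  by rewrite map_inj_uniq ?iota_uniq // => i j /addIr [].
have := @is_sum_fin _ _ _ (fun n => truncT f N n * frob q n z) _ uw.
move=> /(_ _)/(evalT_eq (entire_trunc f N)) ->; last first.
  by move=> n /truncT_win ->; rewrite mul0r.
rewrite /win big_map big_mkord (big_morph _ (frobD q _) (frob0 q _)).
rewrite horner_sum; apply: eq_bigr => j _.
rewrite hornerZ hornerXn /truncT ifT; last by have := ltn_ord j; lia.
by rewrite frobM -frobzD subrKC.
Qed.

Lemma coef_truncP f N n k : n + N%:Z = k%:Z -> (`|n| <= N)%N ->
  (truncP f N)`_(q ^ k) = frob q N%:Z (f n).
Proof.
move=> nk nN; have kN : (k < (N + N).+1)%N by lia.
rewrite coef_sum (bigD1 (Ordinal kN)) //= big1 ?addr0 => [|i ik].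
  by rewrite coefZ coefXn eqxx mulr1 -nk addrK.
rewrite coefZ coefXn eqn_exp2l ?fpow_gt1 // eq_sym.
by move: ik; rewrite -val_eqE /= => /negbTE ->; rewrite mulr0.
Qed.

Lemma coef0_truncP f N : (truncP f N)`_0 = 0.
Proof.
rewrite coef_sum big1 // => i _; rewrite coefZ coefXn eq_sym.
by rewrite expn_eq0 gtn_eqF ?fpow_gt0 // mulr0.
Qed.

Lemma truncT_surj f N n w y : (`|n| <= N)%N -> f n * frob q n y = w ->
  exists2 z, evalT q (truncT f N) z = w & absv z <= absv y.
Proof.
move=> nN fw; have [y0|y0] := eqVneq y 0.
  exists 0; last by rewrite absv0 absv_ge0.
  by rewrite -fw y0 frob0 mulr0 evalT0 //; exact: entire_trunc.
have [k nk] : exists k : nat, n + N%:Z = k%:Z.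
  by exists (absz (n + N%:Z)); rewrite gez0_abs //; lia.
pose P := truncP f N - (frob q N%:Z w)%:P.
have P0 : P`_0 = - frob q N%:Z w by rewrite coefB coef0_truncP coefC sub0r.
have Pk : P`_(q ^ k) = frob q N%:Z (f n).
  by rewrite coefB (coef_truncP _ nk) // coefC gtn_eqF ?expfpow_gt0 // subr0.
(* At radius |y| the term of degree q^k has exactly the size of the constant term. *)
have := @poly_root_le P (absv y) (q ^ k); rewrite absv_gt0 y0 expfpow_gt0.
case=> //.
  rewrite P0 Pk absvN -fw frobM absvM -frobzD addrC nk.
  by rewrite [frob q k _]/frob absvX.
move=> z; rewrite /root hornerD hornerN hornerC horner_truncP subr_eq0 => /eqP.
by move/(can_inj (frobK q N)) => hz zy; exists z.
Qed.

Lemma truncT_ker f N n : (`|n| <= N)%N -> f n != 0 ->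
  exists L : seq C, forall z, evalT q (truncT f N) z = 0 -> z \in L.
Proof.
move=> nN fn; have [k nk] : exists k : nat, n + N%:Z = k%:Z.
  by exists (absz (n + N%:Z)); rewrite gez0_abs //; lia.
have P0 : truncP f N != 0.
  apply: contraNneq fn => P0; rewrite -(frob_eq0 q N) -(coef_truncP f nk) //.
  by rewrite P0 coef0.
have [r Pr] := closed_field_poly_normal (truncP f N).
exists r => z hz; have : root (truncP f N) z by rewrite /root horner_truncP hz frob0.
by rewrite Pr rootZ ?lead_coef_eq0 // root_prod_XsubC.
Qed.

Lemma evalT_trunc_lt f N z eps : entire q f -> 0 < eps ->
  (forall n, (N < `|n|)%N -> absv (f n * frob q n z) < eps) ->
  absv (evalT q (truncT f N) z - evalT q f z) < eps.
Proof.
move=> hf e0 h; rewrite -evalT_subl //; last exact: entire_trunc.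
apply: evalT_lt => //; first by apply: entireB => //; exact: entire_trunc.
move=> n; rewrite /truncT; case: leqP => nN; first by rewrite subrr mul0r absv0.
by rewrite sub0r mulNr absvN; exact: h.
Qed.

Lemma evalT_approx f n w y eps : entire q f -> f n * frob q n y = w -> 0 < eps ->
  exists2 z, absv (w - evalT q f z) < eps & absv z <= absv y.
Proof.
move=> hf fw e0; have [N hN] := (null_int _).1 (entire_null y hf) _ e0.
have [z hz zy] := @truncT_surj f (maxn N `|n|) n w y (leq_maxr _ _) fw.
exists z => //; rewrite -hz; apply: evalT_trunc_lt => // m.
rewrite gtn_max => /andP[Nm _]; apply: le_lt_trans (hN _ Nm).
by rewrite !absvM ler_wpM2l ?absv_ge0 // absv_frob_le.
Qed.

(* Open mapping by successive approximation. *)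
Lemma evalT_surj f n w y : entire q f -> f n != 0 -> f n * frob q n y = w ->
  exists2 z, evalT q f z = w & absv z <= absv y.
Proof.
move=> hf fn fw; have [y0|y0] := eqVneq y 0.
  by exists 0; rewrite ?evalT0 // ?absv0 ?absv_ge0 // -fw y0 frob0 mulr0.
pose Y w' := frob q (- n) ((f n)^-1 * w').
have fY w' : f n * frob q n (Y w') = w' by rewrite frobKV mulVKf.
have Yw : Y w = y by rewrite /Y -fw mulKf // frobK.
have inv_gt0 k : 0 < (k.+1%:R^-1 : R) by rewrite invr_gt0 ltr0n.
have /choice[ee hee] : forall k : nat, exists e : R, 0 < e /\ forall w',
    absv w' < e -> [/\ absv w' < k.+1%:R^-1, absv (Y w') < k.+1%:R^-1
                     & absv (Y w') < absv y].
  move=> k; have d0 : 0 < Num.min k.+1%:R^-1 (absv y) by rewrite lt_min inv_gt0 absv_gt0.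
  have [d1 d10 hd1] := frob_small q (- n) d0.
  have [d2 d20 hd2] := mulr_small (f n)^-1 d10.
  exists (Num.min k.+1%:R^-1 d2); split; first by rewrite lt_min inv_gt0.
  move=> w'; rewrite lt_min => /andP[? /hd2/hd1]; rewrite lt_min => /andP[? ?].
  by split.
have /choice[zz hzz] : forall kw : nat * C, exists z,
    absv (kw.2 - evalT q f z) < ee kw.1 /\ absv z <= absv (Y kw.2).
  move=> [k w']; have [e0 _] := hee k.
  by have [z h1 h2] := evalT_approx hf (fY w') e0; exists z.
pose ws := fix ws k := if k is k'.+1 then ws k' - evalT q f (zz (k', ws k')) else w.
pose zs k := zz (k, ws k).
have ws_lt k : absv (ws k.+1) < ee k by exact: (hzz (k, ws k)).1.
have zs_y k : absv (zs k) <= absv y.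
  apply: le_trans (hzz (k, ws k)).2 _; case: k => [|k]; first by rewrite /= Yw.
  by have [_ _ /ltW] := (hee k).2 _ (ws_lt k).
have inv_small eps : 0 < eps -> exists N : nat, forall k, (N <= k)%N ->
    k.+1%:R^-1 < eps.
  move=> e0; exists (Num.truncn eps^-1) => k Nk.
  rewrite -[ltRHS]invrK ltf_pV2 ?posrE ?invr_gt0 ?ltr0n //.
  by apply: lt_le_trans (truncnS_gt _) _; rewrite ler_nat ltnS.
have zs_null : null_family zs.
  apply/null_nat => eps e0; have [N hN] := inv_small _ e0.
  exists N.+1 => -[//|k] Nk; apply: le_lt_trans (hzz (k.+1, ws k.+1)).2 _.
  have [_ + _] := (hee k).2 _ (ws_lt k); move=> /lt_trans; apply; exact: hN.
have [Z hZ] := is_sum_ex zs_null.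
exists Z; last by apply: (is_sum_le hZ) => //; exact: absv_ge0.
have := is_sum_nat_cvg (evalT_is_sum hf zs_null hZ); move=> /cvgn_absvP hcv.
apply/eqP; rewrite -subr_eq0; apply/eqP/absv_small_eq0 => eps e0.
have [N1 h1] := hcv _ e0; have [N2 h2] := inv_small _ e0.
pose M := (maxn N1 N2).+1.
have sE k : series (fun j => evalT q f (zs j)) k = w - ws k.
  elim: k => [|k IH]; first by rewrite /series /= big_geq // subrr.
  by rewrite /series /= in IH *; rewrite big_nat_recr //= IH opprB -addrA [- _ + _]addrC.
have := h1 M; rewrite sE => /(_ _) h1'.
apply: (absv_dist_lt (h1' _)); first by rewrite /M leqW // leq_maxl.
rewrite addrC addKr absvN.
have [+ _ _] := (hee (maxn N1 N2)).2 _ (ws_lt _); move=> /lt_trans; apply.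
by apply: h2; exact: leq_maxr.
Qed.

Lemma evalT_onto f w : entire q f -> f <> (fun=> 0) -> exists z, evalT q f z = w.
Proof.
move=> hf f0; have [n fn] : exists n, f n != 0.
  apply: contrapT => h; apply: f0; apply/funext => n; apply/eqP.
  by apply: contraT => fn; case: h; exists n.
have [|z hz _] := @evalT_surj f n w (frob q (- n) ((f n)^-1 * w)) hf fn.
  by rewrite frobKV mulVKf.
by exists z.
Qed.

Lemma evalT_inj f g : entire q f -> entire q g ->
  (forall z, evalT q f z = evalT q g z) -> f = g.
Proof.
move=> hf hg fg; apply: contrapT => nfg.
have [|z] := @evalT_onto (fun n => f n - g n) 1 (entireB hf hg).
  move=> h; apply: nfg; apply/funext => n; apply/eqP.
  by rewrite -subr_eq0; have := congr1 (fun u => u n) h => /= ->.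
by rewrite evalT_subl // fg subrr => /esym/eqP; rewrite oner_eq0.
Qed.

End Surjectivity.

(** * Associativity, cancellation and the operator 1 - tau *)

Section CompositionRing.
Variables (R : realType) (C : completeNonarchClosedFieldType R).
Variable q : frobenius_power C.
Implicit Types (a b f g h : int -> C) (x y z c : C) (n m i : int).

Lemma entire_zero : entire q (fun=> 0 : C).
Proof.
by apply/entireP => z; apply: (@null_fin _ _ _ _ [::]) => i _; rewrite mul0r.
Qed.

Lemma evalT_zero z : evalT q (fun=> 0 : C) z = 0.
Proof.
apply: evalT_eq; first exact: entire_zero.
by have := @is_sum0 R C int; apply: eq_is_sum => n; rewrite mul0r.
Qed.

Lemma compTA a b d : entire q a -> entire q b -> entire q d ->
  compT q a (compT q b d) = compT q (compT q a b) d.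
Proof.
move=> ha hb hc; apply: (@evalT_inj _ _ q).
- by apply: entire_comp => //; exact: entire_comp.
- by apply: entire_comp => //; exact: entire_comp.
by move=> z; rewrite !evalT_comp //; exact: entire_comp.
Qed.

Lemma compT_rcancel a b h : entire q a -> entire q b -> entire q h ->
  h <> (fun=> 0) -> compT q a h = compT q b h -> a = b.
Proof.
move=> ha hb hh h0 e; apply: (@evalT_inj _ _ q) => // z.
have [y <-] := evalT_onto z hh h0.
by rewrite -!evalT_comp // e.
Qed.

(** On values [h] may have a kernel, which blocks a direct argument; the adjoint reverses products
    and reduces the claim to cancellation on the right. *)
Lemma compT_lcancel a b h : entire q a -> entire q b -> entire q h ->
  h <> (fun=> 0) -> compT q h a = compT q h b -> a = b.
Proof.
move=> ha hb hh h0 e.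
rewrite -(adjTK q a) -(adjTK q b); congr (adjT q _).
apply: (@compT_rcancel _ _ (adjT q h)); try exact: entire_adj.
  move=> z; apply: h0; rewrite -(adjTK q h) z.
  by apply/funext => n; rewrite /adjT frob0.
by rewrite -!adjT_comp // e.
Qed.

Lemma compT_const f c n : compT q f (constT c) n = f n * frob q n c.
Proof. by rewrite constTE compT_monor subr0. Qed.

Lemma compT_one_sub_tau g n : entire q g ->
  compT q g (@one_sub_tau R C) n = g n - g (n - 1).
Proof.
move=> hg; have hm := entire_coef_null (entire_mono q (1 : C) _).
have h1 := compT_is_sum n hg (hm 0); have h2 := compT_is_sum n hg (hm 1).
have h3 := compT_is_sum n hg (entire_coef_null (entire_one_sub_tau q)).
rewrite !compT_monor !frob1 !mulr1 subr0 in h1 h2.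
apply: (is_sum_unique h3); have := is_sumB h1 h2; apply: eq_is_sum => i.
by rewrite -mulrBr -frobB.
Qed.

Lemma evalT_adj_one_sub_tau z :
  evalT q (adjT q (@one_sub_tau R C)) z = z - frob q (- 1) z.
Proof.
have -> : adjT q (@one_sub_tau R C) = fun n => monoT (1 : C) 0 n - monoT 1 (- 1) n.
  apply/funext => n; rewrite /adjT frobB.
  have := congr1 (fun u => u n) (adjT_mono q (1 : C) 0).
  have := congr1 (fun u => u n) (adjT_mono q (1 : C) 1).
  by rewrite /adjT !frob1 oppr0 => <- <-.
rewrite (evalT_subl _ (entire_mono _ _ _) (entire_mono _ _ _)) !evalT_mono.
by rewrite frobz0 !mul1r.
Qed.

End CompositionRing.

(** * The pairing, its symmetry and its nondegeneracy *)

Section Pairing.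
Variables (R : realType) (C : completeNonarchClosedFieldType R).
Variable q : frobenius_power C.
Implicit Types (a b f g h : int -> C) (x y z alpha beta : C) (n m i : int) (eps : R).

(** The coefficients of g (1 - tau) are g_n - g_(n-1), so partial sums solve g (1 - tau) = a. *)
Definition partT a : int -> C := fun n => zsum (fun i => if i <= n then a i else 0).

Lemma partT_is_sum a n : null_family a ->
  is_sum (fun i => if i <= n then a i else 0) (partT a n).
Proof.
move=> ha; apply: zsumP; apply: null_le ha => i.
by case: ifP => _ //; rewrite absv0 absv_ge0.
Qed.

Lemma partT_is_tail a n : null_family a -> is_sum a 0 ->
  is_sum (fun i => if n < i then - a i else 0) (partT a n).
Proof.
move=> ha h0; have := is_sumB (partT_is_sum n ha) h0; rewrite subr0.
by apply: eq_is_sum => i; case: ltP => _; rewrite ?subrr ?sub0r.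
Qed.

Lemma partT_sub a n : null_family a -> partT a n - partT a (n - 1) = a n.
Proof.
move=> ha; apply: is_sum_unique (is_sumB (partT_is_sum n ha) (partT_is_sum _ ha)) _.
have hn : is_sum (fun i => if i == n then a n else 0) (a n).
  have := @is_sum_single _ _ _ (fun i => if i == n then a n else 0) n.
  by rewrite eqxx; apply=> i /negbTE ->.
apply: eq_is_sum hn => i; case: eqVneq => [->|ni].
  by rewrite lexx ifF ?subr0 //; lia.
have -> : (i <= n - 1) = (i <= n) by lia.
by rewrite subrr.
Qed.

(** With |Z| >= 1 the size of Z^(q^n) grows with n. For n >= 0 the tail is used, as i > n gives |a_i
    Z^(q^n)| <= |a_i Z^(q^i)|; for n < 0 the head, as |Z^(q^n)| <= |Z|. *)
Lemma entire_partT a : entire q a -> is_sum a 0 -> entire q (partT a).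
Proof.
move=> ha h0; have an := entire_coef_null ha.
apply/entireP => z; apply/null_int => eps e0.
have [Z Z1 zZ] : exists2 Z : C, 1 <= absv Z & absv z <= absv Z.
  have [z1|/ltW z1] := leP 1 (absv z); first by exists z.
  by exists 1; rewrite absv1.
have Z0 : 0 < absv Z by exact: lt_le_trans Z1.
have [N hN] := (null_int _).1 (entire_null Z ha) _ e0.
have [M hM] := (null_int _).1 (nullZ Z an) _ e0.
have fZ n : absv (frob q n z) <= absv (frob q n Z) by rewrite absv_frob_le.
have fZ0 n : 0 < absv (frob q n Z) by rewrite absv_gt0 frob_eq0 -absv_gt0.
exists (maxn N M) => n; rewrite gtn_max => /andP[nN nM].
apply: (@le_lt_trans _ _ (absv (partT a n * frob q n Z))).
  by rewrite !absvM ler_wpM2l ?absv_ge0.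
rewrite absvM -ltr_pdivlMr //; have [n0|n0] := leP 0 n.
  apply: (is_sum_lt (partT_is_tail n an h0)); first by rewrite divr_gt0.
  move=> i; case: ifP => [ni|_]; last by rewrite absv0 divr_gt0.
  rewrite absvN ltr_pdivlMr //.
  apply: le_lt_trans (hN i _); last by lia.
  by rewrite absvM ler_wpM2l ?absv_ge0 // absv_frob_mono // ltW.
apply: (is_sum_lt (partT_is_sum n an)); first by rewrite divr_gt0.
move=> i; case: ifP => [ni|_]; last by rewrite absv0 divr_gt0.
rewrite ltr_pdivlMr //.
apply: le_lt_trans (hM i _); last by lia.
rewrite absvM mulrC ler_wpM2r ?absv_ge0 //.
by rewrite -[leRHS](congr1 absv (frobz0 q Z)) absv_frob_mono // ltW.
Qed.

Lemma gT_spec f alpha : entire q f -> kerT q f alpha ->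
  entire q (gT q f alpha) /\
  compT q f (constT alpha) = compT q (gT q f alpha) (@one_sub_tau R C).
Proof.
move=> hf ka; pose a n := f n * frob q n alpha.
have aE : compT q f (constT alpha) = a by apply/funext => n; rewrite compT_const.
have ea : entire q a by rewrite -aE; apply: entire_comp => //; exact: entire_mono.
have a0 : is_sum a 0 by rewrite -ka; exact: evalTP.
apply: (@xgetPex _ (fun=> 0) [set g | entire q g /\ _]).
exists (partT a); split; first exact: entire_partT.
apply/funext => n; rewrite compT_one_sub_tau ?aE; last exact: entire_partT.
by rewrite partT_sub //; exact: entire_coef_null.
Qed.

Lemma one_sub_tau_neq0 : @one_sub_tau R C <> (fun=> 0).
Proof.
move=> /(congr1 (fun u => u 0)); rewrite /one_sub_tau /constT /tauT eqxx /= subr0.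
by apply/eqP; rewrite oner_eq0.
Qed.

Lemma gT_uniq f g alpha : entire q f -> kerT q f alpha -> entire q g ->
  compT q f (constT alpha) = compT q g (@one_sub_tau R C) -> gT q f alpha = g.
Proof.
move=> hf ka hg e; have [h1 h2] := gT_spec hf ka.
apply: (compT_rcancel h1 hg (entire_one_sub_tau q) one_sub_tau_neq0).
by rewrite -h2.
Qed.

Lemma gT_partT f alpha : entire q f -> kerT q f alpha ->
  gT q f alpha = partT (fun n => f n * frob q n alpha).
Proof.
move=> hf ka; pose a n := f n * frob q n alpha.
have aE : compT q f (constT alpha) = a by apply/funext => n; rewrite compT_const.
have ea : entire q a by rewrite -aE; apply: entire_comp => //; exact: entire_mono.
have a0 : is_sum a 0 by rewrite -ka; exact: evalTP.
apply: gT_uniq => //; first exact: entire_partT.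
apply/funext => n; rewrite compT_one_sub_tau ?aE; last exact: entire_partT.
by rewrite partT_sub //; exact: entire_coef_null.
Qed.

Lemma entire_gT f alpha : entire q f -> kerT q f alpha -> entire q (gT q f alpha).
Proof. by move=> hf /(gT_spec hf)[]. Qed.

Lemma pairing_is_sum f alpha beta : entire q f -> kerT q f alpha ->
  is_sum (fun n => frob q (- n) (gT q f alpha n * beta)) (pairing q f alpha beta).
Proof.
move=> hf ka; have hg := entire_adj (entire_gT hf ka).
have := is_sum_reindex (@opprK int) (@opprK int) (evalTP beta hg).
by apply: eq_is_sum => n; rewrite /adjT opprK frobM.
Qed.

Definition half_pairing_term f alpha beta (ni : int * int) : C :=
  if (0 <= ni.1) && (ni.1 < ni.2)
  then frob q (- ni.1) (f ni.2 * frob q ni.2 alpha * beta) else 0.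

(** Let x = f_i alpha^(q^i) beta. For 0 <= n < i the size of x^(q^-n) is at most that of x or of
    x^(q^-i). The first tends to 0 because f converges at alpha, the second because adj f converges
    at beta, and each i meets finitely many n. *)
Lemma null_half_pairing f alpha beta : entire q f ->
  null_family (half_pairing_term f alpha beta).
Proof.
move=> hf eps e0.
have h1 : null_family (fun i => f i * frob q i alpha * beta).
  have := nullZ beta (entire_null alpha hf).
  by apply: eq_null => i; rewrite mulrC.
have h2 : null_family (fun i => frob q (- i) (f i * frob q i alpha * beta)).
  have := nullZ alpha (null_reindex (@opprK int) (entire_null beta (entire_adj hf))).
  by apply: eq_null => i; rewrite /adjT opprK !frobM frobK [in RHS]mulrAC mulrC.
have [N hN] := (null_int _).1 h1 _ e0; have [M hM] := (null_int _).1 h2 _ e0.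
pose K := (maxn N M).+1.
exists [seq (n, i) | n <- map Posz (iota 0 K), i <- map Posz (iota 0 K)] => -[n i] ni.
rewrite /half_pairing_term /=; case: ifP => [/andP[n0 lt_ni]|_]; last by rewrite absv0.
have iK : (maxn N M < `|i|)%N.
  rewrite ltnNge; apply: contra ni => iK.
  apply/allpairsPdep; exists n, i; split => //.
    case: n n0 lt_ni => // n _ lt_ni; rewrite map_f // mem_iota /K.
    by case: i iK lt_ni => // i; lia.
  case: i iK lt_ni => [i|i] iK lt_ni; last by lia.
  by rewrite map_f // mem_iota /K; lia.
move: iK; rewrite gtn_max => /andP[/hN hi1 /hM hi2].
set x := f i * _ * _ in hi1 hi2 *.
have [x1|/ltW x1] := leP 1 (absv x).
  apply: le_lt_trans hi1; rewrite -[leRHS](congr1 absv (frobz0 q x)).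
  by apply: absv_frob_mono => //; lia.
by apply: le_lt_trans hi2; apply: absv_frob_anti => //; lia.
Qed.

(* The double series over all (n, i) with i <= n does not converge; splitting it
   along n < 0 and using that the a_i alpha ^ (q ^ i) sum to 0 when n >= 0 gives
   two convergent halves, which the adjoint exchanges. *)
Lemma pairing_halves f alpha beta S T : entire q f -> kerT q f alpha ->
  is_sum (half_pairing_term f alpha beta) S ->
  is_sum (half_pairing_term (adjT q f) beta alpha) T ->
  pairing q f alpha beta = T - S.
Proof.
(* The involution [phi] carries the pairs i <= n < 0 to the pairs 0 <= n' < i' that index the half
   series of the adjoint. *)
move=> hf ka hS hT; pose phi (ni : int * int) := (ni.1 - ni.2, - ni.2).
have phiK : involutive phi by move=> [n i]; rewrite /phi /= !opprK subrK.
have hTS := is_sumB (is_sum_reindex phiK phiK hT) hS.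
apply: is_sum_unique (pairing_is_sum beta hf ka) _.
apply: (is_sum_fubini hTS) => n; rewrite gT_partT //.
set a := fun n => f n * frob q n alpha.
have an : null_family a by exact: entire_null.
have a0 : is_sum a 0 by rewrite -ka; exact: evalTP.
rewrite mulrC.
have [n0|n0] := leP 0 n.
  have := is_sum_frob q (- n) (is_sumZ beta (partT_is_tail n an a0)).
  apply: eq_is_sum => i; rewrite /half_pairing_term /= n0 /=.
  have -> : (0 <= n - i) && (n - i < - i) = false by lia.
  case: ifP => _; last by rewrite mulr0 frob0 subrr.
  by rewrite sub0r -frobN mulrN mulrC.
have := is_sum_frob q (- n) (is_sumZ beta (partT_is_sum n an)).
apply: eq_is_sum => i; rewrite /half_pairing_term /= [0 <= n]leNgt n0 /= subr0.
have -> : (0 <= n - i) && (n - i < - i) = (i <= n) by lia.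
case: ifP => _; last by rewrite mulr0 frob0.
rewrite /adjT opprK.
have -> : - (n - i) = - n + i by lia.
by rewrite frobzD !(frobM q i) !frobKV /a; congr frob; rewrite mulrC mulrAC.
Qed.

(** The two halves are the same series and cancel. Antisymmetry alone would not give this in
    characteristic 2. *)
Lemma pairing_alternating f alpha : entire q f -> f = adjT q f -> kerT q f alpha ->
  pairing q f alpha alpha = 0.
Proof.
move=> hf fs ka; have [S hS] := is_sum_ex (null_half_pairing alpha alpha hf).
by rewrite (pairing_halves hf ka hS (T := S)) ?subrr // -fs.
Qed.

Lemma pairing_adj f alpha beta : entire q f -> kerT q f alpha ->
  kerT q (adjT q f) beta -> pairing q f alpha beta = - pairing q (adjT q f) beta alpha.
Proof.
move=> hf ka kb; have [S hS] := is_sum_ex (null_half_pairing alpha beta hf).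
have [T hT] := is_sum_ex (null_half_pairing beta alpha (entire_adj hf)).
rewrite (pairing_halves hf ka hS hT) (pairing_halves (entire_adj hf) kb hT (T := S)).
  by rewrite opprB.
by rewrite adjTK.
Qed.

Lemma pairingDr f alpha x y : entire q f -> kerT q f alpha ->
  pairing q f alpha (x + y) = pairing q f alpha x + pairing q f alpha y.
Proof.
by move=> hf ka; rewrite /pairing evalTD //; apply: entire_adj; exact: entire_gT.
Qed.

Lemma pairingZr f alpha c x : entire q f -> kerT q f alpha -> Fq q c ->
  pairing q f alpha (c * x) = c * pairing q f alpha x.
Proof.
by move=> hf ka hc; rewrite /pairing evalT_Fq //; apply: entire_adj; exact: entire_gT.
Qed.

Lemma kerT_comp g h z : entire q g -> entire q h -> kerT q h z ->
  kerT q (compT q g h) z.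
Proof. by move=> hg hh; rewrite /kerT /= evalT_comp // => ->; rewrite evalT0. Qed.

(** Composing h alpha = G (1 - tau) with [g] on the left shows, by uniqueness, that [g] composed
    with [G] belongs to [alpha] for the product; its adjoint applies adj g first. *)
Lemma pairing_comp g h alpha beta : entire q g -> entire q h -> kerT q h alpha ->
  pairing q (compT q g h) alpha beta = pairing q h alpha (evalT q (adjT q g) beta).
Proof.
move=> hg hh ka; have [e1 e2] := gT_spec hh ka.
have hc : entire q (constT alpha) := entire_mono q alpha 0.
rewrite /pairing (_ : gT q (compT q g h) alpha = compT q g (gT q h alpha)).
  by rewrite adjT_comp // evalT_comp //; exact: entire_adj.
apply: gT_uniq; first exact: entire_comp.
- exact: kerT_comp.
- exact: entire_comp.
by rewrite -(compTA hg hh hc) e2 (compTA hg e1 (entire_one_sub_tau q)).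
Qed.

(* With h^* gamma = g (1 - tau), surjectivity of g^* provides alpha with
   g^*(alpha) = 1, and the adjoint identity gamma h = (1 - tau^-1) g^* puts alpha
   in the kernel of h. *)
Lemma pairing_nondegenerate h gamma : entire q h -> h <> (fun=> 0) ->
  kerT q (adjT q h) gamma ->
  (forall alpha, kerT q h alpha -> pairing q h alpha gamma = 0) -> gamma = 0.
Proof.
move=> hh h0 kg hp; apply/eqP; apply: contraT => g0.
have ha := entire_adj hh.
have [e1 e2] := gT_spec ha kg; set G := gT _ _ _ in e1 e2.
have eG := entire_adj e1.
have key z : gamma * evalT q h z =
    evalT q (adjT q G) z - frob q (- 1) (evalT q (adjT q G) z).
  have := congr1 (adjT q) e2; have et := entire_one_sub_tau q.
  rewrite !adjT_comp //; last exact: entire_mono.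
  rewrite adjTK adjT_const => /(congr1 (fun u => evalT q u z)).
  rewrite !evalT_comp //; [|exact: entire_adj|exact: entire_mono].
  by rewrite evalT_const evalT_adj_one_sub_tau.
have G0 : adjT q G <> (fun=> 0).
  move=> G0; have [z hz] := evalT_onto 1 hh h0.
  have := key z; rewrite G0 evalT_zero frob0 subrr hz mulr1.
  by move/eqP; rewrite (negbTE g0).
have [alpha hal] := evalT_onto 1 eG G0.
have ka : kerT q h alpha.
  have := key alpha; rewrite hal frob1 subrr => /eqP.
  by rewrite mulf_eq0 (negbTE g0) /= => /eqP.
have := hp _ ka; rewrite (pairing_adj hh ka kg) /pairing -/G hal => /eqP.
by rewrite oppr_eq0 oner_eq0.
Qed.

End Pairing.

(** * Series with trivial kernel are monomials *)

Section TrivialKernel.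
Variables (R : realType) (C : completeNonarchClosedFieldType R).
Variable q : frobenius_power C.
Implicit Types (u : int -> C) (x y z A B : C) (n m i j k : int).

(** The term of higher index shrinks faster as |x| decreases, so a lower term that wins at [x']
    keeps winning further in. This and the next two lemmas replace the convexity of the Newton
    polygon. *)
Lemma term_le_down j m x x' A B : m <= j -> x' != 0 -> absv x <= absv x' ->
  absv (A * frob q j x') <= absv (B * frob q m x') ->
  absv (A * frob q j x) <= absv (B * frob q m x).
Proof.
move=> mj x0 xx h; have [y -> y1] : exists2 y, x = x' * y & absv y <= 1.
  exists (x / x'); first by rewrite mulrC divfK.
  by rewrite absvM absvV ler_pdivrMr ?mul1r // absv_gt0.
rewrite !frobM !mulrA !(absvM (_ * _)) ler_pM ?absv_ge0 //.
exact: absv_frob_anti.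
Qed.

Lemma term_lt_down j m x x' A B : m <= j -> x != 0 -> x' != 0 ->
  absv x <= absv x' -> absv (A * frob q j x') < absv (B * frob q m x') ->
  absv (A * frob q j x) < absv (B * frob q m x).
Proof.
move=> mj x0 x'0 xx h; have [y yE y1] : exists2 y, x = x' * y & absv y <= 1.
  exists (x / x'); first by rewrite mulrC divfK.
  by rewrite absvM absvV ler_pdivrMr ?mul1r // absv_gt0.
have y0 : y != 0 by apply: contraNneq x0 => y0; rewrite yE y0 mulr0.
rewrite yE !frobM !mulrA !(absvM (_ * _)).
apply: (@lt_le_trans _ _ (absv (B * frob q m x') * absv (frob q j y))).
  by rewrite ltr_pM2r // absv_gt0 frob_eq0.
by rewrite ler_wpM2l ?absv_ge0 // absv_frob_anti.
Qed.

Lemma term_le_up j m x x' A B : j <= m -> x' != 0 -> absv x' <= absv x ->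
  absv (A * frob q j x') <= absv (B * frob q m x') ->
  absv (A * frob q j x) <= absv (B * frob q m x).
Proof.
move=> mj x0 xx h; have [y -> y1] : exists2 y, x = x' * y & 1 <= absv y.
  exists (x / x'); first by rewrite mulrC divfK.
  by rewrite absvM absvV ler_pdivlMr ?mul1r // absv_gt0.
rewrite !frobM !mulrA !(absvM (_ * _)) ler_pM ?absv_ge0 //.
exact: absv_frob_mono.
Qed.

(** For x = t^(q^-m) the tie amounts to t^(q^(n-m) - 1) = u_m / u_n, solvable in a closed field. The
    vertices of the Newton polygon are thus realised by points of [C]. *)
Lemma term_crossing u m n : m < n -> u m != 0 -> u n != 0 ->
  exists2 x, x != 0 & u m * frob q m x = u n * frob q n x.
Proof.
move=> mn um un; have [d dE] : exists d : nat, n = m + d.+1%:Z.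
  by exists (absz (n - m)).-1; lia.
have d0 : (0 < (q ^ d.+1).-1)%N.
  by rewrite -ltnS prednK ?expfpow_gt0 // -[X in (X < _)%N](expn0 q) ltn_exp2l ?fpow_gt1.
have [t ht] : exists t : C, t ^+ (q ^ d.+1).-1 = u m / u n.
  have [t ht] := solve_monicpoly (fun i : nat => if i == 0%N then u m / u n else 0) d0.
  exists t; rewrite ht; case: _.-1 d0 => // N _.
  by rewrite big_ord_recl /= expr0 mulr1 big1 ?addr0 // => i _; rewrite mul0r.
have t0 : t != 0.
  apply: contra_eq_neq ht => ->; rewrite expr0n gtn_eqF // eq_sym.
  by rewrite mulf_neq0 ?invr_eq0.
exists (frob q (- m) t); first by rewrite frob_eq0.
have -> : frob q n (frob q (- m) t) = t * t ^+ (q ^ d.+1).-1.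
  by rewrite dE [m + _]addrC frobzD frobKV -exprS prednK ?expfpow_gt0.
rewrite frobKV ht.
by rewrite [RHS]mulrCA [u n * _]mulrC divfK // mulrC.
Qed.

Lemma seq_argmin (I : eqType) (F : I -> R) (s : seq I) (i0 : I) : i0 \in s ->
  exists2 i : I, i \in s & forall j : I, j \in s -> F i <= F j.
Proof.
elim: s i0 => // a s IH i0 _; case: s IH => [_|b s IH].
  by exists a; rewrite ?mem_head // => j; rewrite inE => /eqP ->.
have [i si hi] := IH b (mem_head _ _).
have [h|/ltW h] := leP (F a) (F i).
  exists a; rewrite ?mem_head // => j; rewrite inE => /predU1P[->//|/hi].
  exact: le_trans.
exists i; first by rewrite inE si orbT.
by move=> j; rewrite inE => /predU1P[->//|/hi].
Qed.

(** Controlled surjectivity provides a preimage z' of u(z) with |u_n z'^(q^n)| <= |u(z)|, and the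
    trivial kernel forces z' = z. *)
Lemma kerT0_term_le u : entire q u -> (forall z, evalT q u z = 0 -> z = 0) ->
  forall n z, absv (u n * frob q n z) <= absv (evalT q u z).
Proof.
move=> hu ku n z; rewrite leNgt; apply/negP => h.
have un : u n != 0 by apply: contraTneq h => ->; rewrite mul0r absv0 -leNgt absv_ge0.
pose Y := frob q (- n) ((u n)^-1 * evalT q u z).
have [|z' hz' z'Y] := @evalT_surj _ _ q u n (evalT q u z) Y hu un.
  by rewrite frobKV mulVKf.
have /eqP : z - z' = 0 by apply: ku; rewrite evalTB // hz' subrr.
rewrite subr_eq0 => /eqP zz; have : absv Y < absv z.
  rewrite -(absv_frob_lt q n) frobKV absvM absvV mulrC ltr_pdivrMr ?absv_gt0 //.
  by rewrite mulrC -absvM.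
by rewrite ltNge zz z'Y.
Qed.

(* A tie between dominant terms at x would let a root of the polynomial made of
   those terms, necessarily of absolute value 1, cancel them all. *)
Lemma kerT0_dominant_unique u : entire q u ->
  (forall z, evalT q u z = 0 -> z = 0) ->
  forall x k, x != 0 -> u k != 0 ->
  (forall i, absv (u i * frob q i x) <= absv (u k * frob q k x)) ->
  forall i, i != k -> absv (u i * frob q i x) < absv (u k * frob q k x).
Proof.
move=> hu ku x k x0 uk hk i ik; rewrite lt_neqAle hk andbT; apply/negP => /eqP tie.
set M := absv (u k * frob q k x) in hk tie.
have M0 : 0 < M by rewrite absv_gt0 mulf_neq0 ?frob_eq0.
pose d j := if absv (u j * frob q j x) == M then u j * frob q j x else 0.
have dk : absv (d k) = M by rewrite /d eqxx.
have di : absv (d i) = M by rewrite /d tie eqxx.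
have d01 j : d j != 0 -> absv (d j) = M.
  by rewrite /d; case: ifP => [/eqP ->//|]; rewrite eqxx.
have [N hN] := (null_int _).1 (entire_null x hu) _ M0.
have dN j : (N < `|j|)%N -> d j = 0.
  by move=> /hN; rewrite /d lt_neqAle => /andP[/negbTE ->].
have kN : (`|k| <= N)%N.
  rewrite leqNgt; apply/negP => /dN dk0; move: dk M0.
  by rewrite dk0 absv0 => <-; rewrite ltxx.
have iN : (`|i| <= N)%N.
  rewrite leqNgt; apply/negP => /dN dk0; move: di M0.
  by rewrite dk0 absv0 => <-; rewrite ltxx.
have dT : truncT d N = d.
  by apply/funext => j; rewrite /truncT; case: leqP => // /dN ->.
have hd : entire q d by rewrite -dT; exact: entire_trunc.
have [y y0 hy] : exists2 y, y != 0 & evalT q d y = 0.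
  have [r Pr] := closed_field_poly_normal (truncP q d N).
  have Pc j : (`|j| <= N)%N -> d j != 0 -> exists2 l : nat, j + N%:Z = l%:Z &
      (truncP q d N)`_(q ^ l) != 0.
    move=> jN dj; exists (absz (j + N%:Z)); first by lia.
    by rewrite (@coef_truncP _ _ q d N j) ?frob_eq0 //; lia.
  have [|l1 e1 c1] := Pc _ kN; first by rewrite -absv_gt0 dk.
  have [|l2 e2 c2] := Pc _ iN; first by rewrite -absv_gt0 di.
  have P0 : truncP q d N != 0 by apply: contraNneq c1 => ->; rewrite coef0.
  have [/hasP[y yr y0]|/hasPn hr] := boolP (has (fun y => y != 0) r).
    exists y => //; have : root (truncP q d N) y.
      by rewrite Pr rootZ ?lead_coef_eq0 // root_prod_XsubC.
    by rewrite /root horner_truncP dT frob_eq0 => /eqP.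
  (* Without a nonzero root the polynomial would be a multiple of a power of X, although its
     coefficients of the distinct degrees q^l1 and q^l2 are nonzero. *)
  have PX : truncP q d N = lead_coef (truncP q d N) *: 'X^(size r).
    rewrite {1}Pr; congr (_ *: _); rewrite -[size r]count_predT -iter_mulr_1.
    rewrite -big_const_seq; apply: eq_big_seq => z /hr; rewrite negbK => /eqP ->.
    by rewrite subr0.
  have s12 l : (truncP q d N)`_(q ^ l) != 0 -> (q ^ l)%N = size r.
    by rewrite PX coefZ coefXn; case: (eqVneq (q ^ l)%N) => // _; rewrite mulr0 eqxx.
  have s1 := s12 _ c1; have s2 := s12 _ c2.
  have : (q ^ l1 == q ^ l2)%N by rewrite s1 s2.
  rewrite eqn_exp2l ?fpow_gt1 // => /eqP l12; case/eqP: ik; lia.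
(* The nonzero coefficients of [d] all have absolute value [M]; if |y| differed from 1, their terms
   at [y] would have distinct sizes and could not cancel. *)
have y1 : absv y = 1.
  apply/eqP; apply: contraT => y1.
  have [|m [dm hm _]] := null_int_max (entire_null y hd).
    by exists k; rewrite mulf_neq0 ?frob_eq0 // -absv_gt0 dk.
  have dm0 : d m != 0 by apply: contraNneq dm => ->; rewrite mul0r.
  have := is_sum_dominant (evalTP y hd) (k := m); rewrite hy absv0 => /(_ _) hs.
  have : absv (d m * frob q m y) = 0.
    apply/esym/hs => j jm; rewrite lt_neqAle hm andbT; apply: contra jm => /eqP e.
    have dj0 : d j != 0.
      by apply: contraNneq dm => dj; rewrite -absv_eq0P -e dj mul0r absv0.
    move: e; rewrite !absvM (d01 _ dj0) (d01 _ dm0) => /(mulfI (lt0r_neq0 M0)).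
    by move=> /(absv_frob_inj y0 y1) ->.
  by move/absv_eq0/eqP; rewrite (negbTE dm).
have fy1 j : absv (frob q j y) = 1.
  by rewrite (absv_frob_eq q j (y := 1)) ?frob1 absv1.
have hux : is_sum (fun j => u j * frob q j x * frob q j y) (evalT q u (x * y)).
  by have := evalTP (x * y) hu; apply: eq_is_sum => j; rewrite frobM mulrA.
have hlt : absv (evalT q u (x * y)) < M.
  have := is_sumB hux (evalTP y hd); rewrite hy subr0 => h.
  apply: (is_sum_lt h) => // j; rewrite -mulrBl absvM fy1 mulr1 /d.
  by case: eqP => [_|/eqP e]; rewrite ?subrr ?absv0 // subr0 lt_neqAle e hk.
have := kerT0_term_le hu ku k (x * y).
by rewrite frobM mulrA absvM fy1 mulr1 leNgt hlt.
Qed.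

(** Moving outward from [x], the first point where a later term catches up with the [m]-th one would
    still have [m] dominant, and tied, against uniqueness. *)
Lemma kerT0_dominant_top u : entire q u -> (forall z, evalT q u z = 0 -> z = 0) ->
  forall x m, x != 0 -> u m != 0 ->
  (forall i, absv (u i * frob q i x) <= absv (u m * frob q m x)) ->
  forall n, m < n -> u n = 0.
Proof.
move=> hu ku x m x0 um hm n1 mn1; apply/eqP; apply: contraT => un1.
have hs := kerT0_dominant_unique hu ku x0 um hm.
have /choice[X hX] : forall n, exists z : C, m < n -> u n != 0 ->
    z != 0 /\ u m * frob q m z = u n * frob q n z.
  move=> n; have [/andP[mn un]|] := boolP ((m < n) && (u n != 0)).
    by have [z z0 hz] := term_crossing mn um un; exists z.
  by move=> h; exists 0 => mn un; rewrite mn un in h.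
have [x10 hx1] := hX _ mn1 un1.
have M0 : 0 < absv (u m * frob q m (X n1)) by rewrite absv_gt0 mulf_neq0 ?frob_eq0.
(* Finitely many crossings compete for the smallest |X n|: a later term of index outside [s] is
   still below the [m]-th one at [X n1]. *)
have [s hsm] := entire_null (X n1) hu M0.
pose s' := [seq n <- n1 :: s | (m < n) && (u n != 0)].
have n1s : n1 \in s' by rewrite mem_filter mn1 un1 mem_head.
have [n ns nmin] := seq_argmin (fun n => absv (X n)) n1s.
move: (ns); rewrite mem_filter => /andP[/andP[mn un] _].
have [xn0 hxn] := hX _ mn un.
have xxn : absv x <= absv (X n).
  rewrite leNgt; apply/negP => /ltW lt.
  have nm : n != m by apply: contraTneq mn => ->; rewrite ltxx.
  have := term_lt_down (ltW mn) xn0 x0 lt (hs _ nm).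
  by rewrite hxn ltxx.
have dom j : absv (u j * frob q j (X n)) <= absv (u m * frob q m (X n)).
  have [jm|mj|->//] := ltgtP j m.
    exact: term_le_up (ltW jm) x0 xxn (hm j).
  have [->|uj] := eqVneq (u j) 0; first by rewrite mul0r absv0 absv_ge0.
  have [js|js] := boolP (j \in s').
    have [xj0 hxj] := hX _ mj uj.
    by apply: term_le_down (ltW mj) xj0 (nmin _ js) _; rewrite hxj.
  apply: term_le_down (ltW mj) x10 (nmin _ n1s) _; apply/ltW/hsm.
  by apply: contra js => js; rewrite mem_filter mj uj inE js orbT.
have nm : n != m by apply: contraTneq mn => ->; rewrite ltxx.
by have := kerT0_dominant_unique hu ku xn0 um dom nm; rewrite hxn ltxx.
Qed.

(** Indices above the one dominant at 1 are excluded directly. If some k < m survived, then where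
    the terms k and m tie the dominant index would be some k' < m, and the same exclusion applied
    there would kill u_m. *)
Lemma kerT0_mono u : entire q u -> u <> (fun=> 0) ->
  (forall z, evalT q u z = 0 -> z = 0) ->
  exists n, exists2 c, c != 0 & u = monoT c n.
Proof.
move=> hu u0 ku.
have dominant x : x != 0 -> (exists n, u n != 0) -> exists2 k, u k != 0 &
    forall i, absv (u i * frob q i x) <= absv (u k * frob q k x).
  move=> x0 [n un]; have [|k [+ hk _]] := null_int_max (entire_null x hu).
    by exists n; rewrite mulf_neq0 ?frob_eq0.
  by rewrite mulf_eq0 negb_or => /andP[uk _]; exists k.
have ex : exists n, u n != 0.
  apply: contrapT => h; apply: u0; apply/funext => n; apply/eqP.
  by apply: contraT => un; case: h; exists n.
have [m um hm] := dominant 1 (oner_neq0 _) ex.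
have top := kerT0_dominant_top hu ku (oner_neq0 _) um hm.
exists m, (u m) => //; apply/funext => k; rewrite /monoT.
case: eqVneq => [->//|km]; apply/eqP; apply: contraT => uk.
have lt_km : k < m.
  by rewrite lt_neqAle km leNgt; apply: contra uk => /top ->.
have [x x0 hx] := term_crossing lt_km uk um.
have [k' uk' hk'] := dominant x x0 ex.
have lt_k'm : k' < m.
  rewrite lt_neqAle; apply/andP; split; last first.
    by rewrite leNgt; apply: contra uk' => /top ->.
  apply: contraTneq isT => k'm; rewrite k'm in hk'.
  by have := kerT0_dominant_unique hu ku x0 um hk' km; rewrite hx ltxx.
by have := kerT0_dominant_top hu ku x0 uk' hk' lt_k'm => e; rewrite e eqxx in um.
Qed.

End TrivialKernel.

(** * Topology of kernels and maximal isotropic subspaces *)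

Section Kernels.
Variables (R : realType) (C : completeNonarchClosedFieldType R).
Variable q : frobenius_power C.
Implicit Types (f g h : int -> C) (x y z : C) (H : set C) (eps r : R).

Lemma closed_absvP H : closed H <->
  forall x, (forall eps, 0 < eps -> exists2 y, H y & absv (x - y) < eps) -> H x.
Proof.
split=> hH x hx; apply: hH => //.
  move=> B /nbhs_ballP[eps /= e0 hB]; have [y Hy xy] := hx _ e0.
  by exists y; split => //; apply: hB; rewrite absv_ball.
move=> eps e0; have [y [Hy]] := hx (ball x eps) (nbhsx_ballx _ _ e0).
by rewrite absv_ball /= => xy; exists y.
Qed.

Lemma closed_kerT f : entire q f -> closed (kerT q f).
Proof.
move=> hf; apply/closed_absvP => x hx; apply: absv_small_eq0 => eps e0.
have [d d0 hd] := evalT_small hf e0; have [y ky xy] := hx _ d0.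
have -> : evalT q f x = evalT q f (x - y) by rewrite evalTB // ky subr0.
by apply: evalT_lt => // n; exact: hd.
Qed.

Lemma closed_in_kerT f H : entire q f -> H `<=` kerT q f ->
  closed_in (kerT q f) H <-> closed H.
Proof.
move=> hf Hk; split=> [[Z Zc ->]|Hc]; first by apply: closedI => //; exact: closed_kerT.
by exists H => //; apply/esym/setIidPr.
Qed.

Lemma Fq_subspace_kerT f : entire q f -> Fq_subspace q (kerT q f).
Proof.
move=> hf; split; rewrite /kerT /=; first exact: evalT0.
- by move=> x y hx hy; rewrite evalTD // hx hy addr0.
- by move=> c x hc hx; rewrite evalT_Fq // hx mulr0.
Qed.

Lemma Fq_finite : exists L : seq C, forall c, Fq q c -> c \in L.
Proof.
have [|L hL] := @truncT_ker _ _ q (@one_sub_tau R C) 1 0 isT.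
  by rewrite /one_sub_tau /constT /tauT /= subr0 oner_neq0.
exists L => c hc; apply: hL.
have -> : truncT (@one_sub_tau R C) 1 = @one_sub_tau R C.
  apply/funext => n; rewrite /truncT; case: leqP => // n1.
  by rewrite /one_sub_tau /constT /tauT; do 2 (rewrite ifF; last by lia); rewrite subrr.
by rewrite evalT_one_sub_tau hc subrr.
Qed.

(** Turns a real radius into a point of [C] where series can be evaluated. Powers of some |u| > 1
    are unbounded by the Bernoulli inequality; if there is no such u, then 1 serves. *)
Lemma absv_bounded_by r : exists Z : C, forall z : C, absv z <= r -> absv z <= absv Z.
Proof.
have [[u u1]|h] := pselect (exists u : C, 1 < absv u); last first.
  exists 1 => z _; rewrite absv1 leNgt; apply/negP => z1; apply: h; by exists z.
have bern (t : R) (n : nat) : 0 <= t -> 1 + n%:R * t <= (1 + t) ^+ n.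
  move=> t0; elim: n => [|n IH]; first by rewrite mul0r addr0 expr0.
  rewrite exprS; apply: (@le_trans _ _ ((1 + t) * (1 + n%:R * t))).
    rewrite mulrDl mul1r mulrDr mulr1 -natr1 mulrDl mul1r addrA.
    by rewrite lerD // ?lerDl ?mulr_ge0 ?ler0n // addrAC.
  by rewrite ler_wpM2l // addr_ge0.
pose t := absv u - 1; have t0 : 0 < t by rewrite subr_gt0.
exists (u ^+ (Num.truncn (r / t)).+1) => z /le_trans; apply.
rewrite absvX (_ : absv u = 1 + t); last by rewrite subrKC.
apply: le_trans (bern _ _ (ltW t0)); rewrite -[r](divfK (lt0r_neq0 t0)) -[leLHS]add0r.
rewrite mulfK ?lt0r_neq0 // lerD // ler_pM2r //.
by apply/ltW; exact: truncnS_gt.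
Qed.

(* A zero z of f is a near-zero of a truncation of f, which surjectivity moves to
   one of the finitely many zeros of that truncation. *)
Lemma kerT_totally_bounded f r eps : entire q f -> f <> (fun=> 0) -> 0 < eps ->
  exists L : seq C, forall z, kerT q f z -> absv z <= r ->
    exists2 l, l \in L & absv (z - l) < eps.
Proof.
move=> hf f0 e0; have [n fn] : exists n, f n != 0.
  apply: contrapT => h; apply: f0; apply/funext => n; apply/eqP.
  by apply: contraT => fn; case: h; exists n.
have [Z hZ] := absv_bounded_by r.
have [d1 d10 hd1] := frob_small q (- n) e0.
have [d2 d20 hd2] := mulr_small (f n)^-1 d10.
have [N hN] := (null_int _).1 (entire_null Z hf) _ d20.
pose M := maxn N `|n|.
have [L hL] := @truncT_ker _ _ q f M n (leq_maxr _ _) fn.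
exists L => z kz zr; pose w := evalT q (truncT f M) z.
have wd2 : absv w < d2.
  have -> : w = w - evalT q f z by rewrite kz subr0.
  apply: evalT_trunc_lt => // m; rewrite gtn_max => /andP[Nm _].
  apply: le_lt_trans (hN _ Nm).
  by rewrite !absvM ler_wpM2l ?absv_ge0 // absv_frob_le hZ.
pose Y := frob q (- n) ((f n)^-1 * w).
have [|d hd dY] := @truncT_surj _ _ q f M n w Y (leq_maxr _ _).
  by rewrite frobKV mulVKf.
exists (z - d); last by rewrite subKr; apply: le_lt_trans dY _; apply: hd1; exact: hd2.
by apply: hL; rewrite evalTB ?hd ?subrr //; exact: entire_trunc.
Qed.

Lemma kerT_subset_separable f H : entire q f -> f <> (fun=> 0) ->
  H `<=` kerT q f -> H 0 ->
  exists2 v : nat -> C, forall n, H (v n) &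
    forall z eps, H z -> 0 < eps -> exists n, absv (z - v n) < eps.
Proof.
move=> hf f0 Hk H0.
have /choice[L hL] : forall NM : nat * nat, exists L : seq C, forall z,
    kerT q f z -> absv z <= NM.1%:R ->
    exists2 l, l \in L & absv (z - l) < NM.2.+1%:R^-1.
  by move=> [N M]; apply: kerT_totally_bounded => //; rewrite invr_gt0 ltr0n.
(* The points of the nets need not lie in [H]: each is replaced by an equally near point of [H] if
   there is one, and by 0 otherwise. *)
pose near_pt (x : nat * nat * nat) : set C :=
  [set y | H y /\ absv (nth 0 (L x.1) x.2 - y) < x.1.2.+1%:R^-1].
pose v n := if (unpickle n : option (nat * nat * nat)) is Some x
            then xget 0 (near_pt x) else 0.
exists v.
  move=> n; rewrite /v; case: unpickle => // x.
  by case: xgetP => [y -> []|_].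
move=> z eps Hz e0.
pose N := (Num.truncn (absv z)).+1; pose M := Num.truncn eps^-1.
have zN : absv z <= N%:R by apply/ltW; exact: truncnS_gt.
have Meps : M.+1%:R^-1 < eps.
  rewrite -[ltRHS]invrK ltf_pV2 ?posrE ?invr_gt0 ?ltr0n //; exact: truncnS_gt.
have [l lL zl] := hL (N, M) z (Hk _ Hz) zN.
exists (pickle ((N, M), index l (L (N, M)))); rewrite /v pickleK.
apply: lt_trans Meps; apply: (absv_dist_lt zl).
have hz : near_pt ((N, M), index l (L (N, M))) z.
  by split => //=; rewrite nth_index // absvB.
have [_] := @xgetPex _ 0 _ (ex_intro _ _ hz); set y := xget _ _.
by rewrite /= nth_index.
Qed.

(** For alpha in ker h the pairing of [f] is that of [h] with h(beta). If beta in ker f is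
    orthogonal to ker h, then h(beta) lies in ker (adj h) and is orthogonal to all of ker h, hence
    is 0. *)
Lemma comp_adj_maximal_isotropic f h : entire q f -> f <> (fun=> 0) ->
  entire q h -> f = compT q (adjT q h) h ->
  maximal_isotropic_closed_subspace q f (kerT q h).
Proof.
move=> hf f0 hh fE; have ha := entire_adj hh.
have h0 : h <> (fun=> 0).
  move=> h0; apply: f0; rewrite fE h0; apply: (@evalT_inj _ _ q).
  - by apply: entire_comp; [apply: entire_adj|]; exact: entire_zero.
  - exact: entire_zero.
  move=> z; rewrite evalT_comp ?evalT_zero ?evalT0 //; try exact: entire_zero.
  - by apply: entire_adj; exact: entire_zero.
  - by apply: entire_adj; exact: entire_zero.
have pE alpha beta : kerT q h alpha ->
    pairing q f alpha beta = pairing q h alpha (evalT q h beta).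
  by move=> ka; rewrite fE pairing_comp // adjTK.
have hk : kerT q h `<=` kerT q f by move=> z kz; rewrite fE; exact: kerT_comp.
split.
  split=> //; first exact: Fq_subspace_kerT.
    by apply/closed_in_kerT => //; exact: closed_kerT.
  move=> alpha beta ka kb; rewrite pE // kb /pairing evalT0 //.
  by apply: entire_adj; exact: entire_gT.
move=> H' [H'k _ _ H'iso] hH'; apply/seteqP; split=> // beta Hb.
apply: (@pairing_nondegenerate _ _ q h) => //.
  by have := H'k _ Hb; rewrite /kerT /= fE evalT_comp.
by move=> alpha ka; rewrite -pE //; apply: H'iso => //; exact: hH'.
Qed.

(** As F_q is finite, this is a finite union of translates of [H], and a point outside keeps a
    positive distance from all of them. *)
Lemma closed_adjoin H beta : closed H ->
  closed [set z | exists x c, [/\ H x, Fq q c & z = x + c * beta]].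
Proof.
move=> /closed_absvP Hc; apply/closed_absvP => z hz.
have [L hL] := Fq_finite.
apply: contrapT => nz.
have [eps e0 he] : exists2 eps : R, 0 < eps & forall c, c \in L -> Fq q c ->
    forall x, H x -> eps <= absv (z - (x + c * beta)).
  elim: L {hL} => [|c L [eps e0 IH]]; first by exists 1.
  have [e1 e10 h1] : exists2 e1 : R, 0 < e1 & Fq q c ->
      forall x, H x -> e1 <= absv (z - (x + c * beta)).
    apply: contrapT => h; have hc : Fq q c.
      by apply: contrapT => nc; apply: h; exists 1.
    apply: nz; exists (z - c * beta), c; split=> //; last by rewrite subrK.
    apply: Hc => d d0; apply: contrapT => h'; apply: h; exists d => // _ x Hx.
    rewrite leNgt; apply/negP => lt; apply: h'; exists x => //.
    by move: lt; rewrite opprD addrA addrAC.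
  exists (Num.min eps e1); first by rewrite lt_min e0.
  move=> c'; rewrite inE => /predU1P[->|c'L] hc' x Hx; rewrite ge_min.
    by rewrite h1 // orbT.
  by rewrite (IH _ c'L hc' _ Hx).
have [_ [x [c [Hx hc ->]]]] := hz _ e0.
by rewrite ltNge (he _ (hL _ hc) hc _ Hx).
Qed.

(** Since beta is orthogonal to itself, H + F_q beta is again isotropic and closed, so maximality
    absorbs it. *)
Lemma maximal_isotropic_perp f H beta : entire q f -> f = adjT q f ->
  maximal_isotropic_closed_subspace q f H -> kerT q f beta ->
  (forall alpha, H alpha -> pairing q f alpha beta = 0) -> H beta.
Proof.
move=> hf fs [[Hk [H0 HD HZ] Hc Hiso] Hmax] kb hp.
have [k0 kD kZ] := Fq_subspace_kerT hf.
have skew x y : kerT q f x -> kerT q f y -> pairing q f x y = - pairing q f y x.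
  by move=> kx ky; have := @pairing_adj _ _ q f x y hf kx; rewrite -fs; exact.
have Fq0 : Fq q (0 : C) by rewrite /Fq /= expr0n gtn_eqF // fpow_gt0.
have Fq1 : Fq q (1 : C) by rewrite /Fq /= expr1n.
pose H' := [set z | exists x c, [/\ H x, Fq q c & z = x + c * beta]].
have HH' : H `<=` H' by move=> x Hx; exists x, 0; split=> //; rewrite mul0r addr0.
have H'k : H' `<=` kerT q f.
  by move=> _ [x [c [Hx hc ->]]]; apply: kD; [exact: Hk | exact: kZ].
rewrite -(Hmax H') //; first by exists 0, 1; split=> //; rewrite add0r mul1r.
split=> //.
- split; first exact: HH'.
  + move=> _ _ [x [c [Hx hc ->]]] [y [d [Hy hd ->]]].
    exists (x + y), (c + d); split; [exact: HD| |by rewrite mulrDl addrACA].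
    have := exprD_fpow q 1 c d; rewrite expn1 => e.
    by rewrite /Fq /= e hc hd.
  + move=> d _ hd [x [c [Hx hc ->]]]; exists (d * x), (d * c).
    split; [exact: HZ| |by rewrite mulrDr mulrA].
    by rewrite /Fq /= exprMn hc hd.
- apply/closed_in_kerT => //; apply: closed_adjoin.
  by apply/(closed_in_kerT hf).
have lin x y c : kerT q f x -> Fq q c -> pairing q f x (y + c * beta) =
    pairing q f x y + c * pairing q f x beta.
  by move=> kx hc; rewrite pairingDr // pairingZr.
have bb : pairing q f beta beta = 0 by exact: pairing_alternating.
move=> _ gamma [x [c [Hx hc ->]]] Hg; have kg := H'k _ Hg.
have kx := Hk _ Hx.
have kxc : kerT q f (x + c * beta) by apply: kD => //; exact: kZ.
case: Hg kg => y [d [Hy hd ->]] kg; have ky := Hk _ Hy.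
rewrite skew // lin // (skew _ x) // lin // Hiso // hp // mulr0 addr0 oppr0 add0r.
rewrite (skew _ beta) // lin // bb mulr0 addr0 (skew beta y) // hp //.
by rewrite !oppr0 mulr0 oppr0.
Qed.

End Kernels.

(** * Divisors with prescribed kernel, and the factorisation *)

Section Divisor.
Variables (R : realType) (C : completeNonarchClosedFieldType R).
Variable q : frobenius_power C.
Implicit Types (f g h : int -> C) (x y z w c d : C) (k s : int) (eps : R).

(* The coefficient of index 0 is a dominant term at 1, and the last one. *)
Definition normalT f : Prop :=
  [/\ absv (f 0) = 1, forall k, absv (f k) <= 1 & forall k, 0 < k -> absv (f k) < 1].

Lemma normalT_neq0 f : normalT f -> f <> (fun=> 0).
Proof.
by move=> [h _ _] f0; move: h; rewrite f0 absv0 => /esym/eqP; rewrite oner_eq0.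
Qed.

Definition binT c s : int -> C := fun n => monoT 1 0 n - monoT c s n.

Lemma entire_bin c s : entire q (binT c s).
Proof. by apply: entireB; exact: entire_mono. Qed.

Lemma evalT_bin c s z : evalT q (binT c s) z = z - c * frob q s z.
Proof.
rewrite (evalT_subl _ (entire_mono _ _ _) (entire_mono _ _ _)) !evalT_mono.
by rewrite frobz0 mul1r.
Qed.

Lemma compT_binl c s h n : entire q h ->
  compT q (binT c s) h n = h n - c * frob q s (h (n - s)).
Proof.
move=> hh; have hn := entire_coef_null hh.
have h1 := compT_is_sum n (entire_mono q 1 0) hn.
have h2 := compT_is_sum n (entire_mono q c s) hn.
have h3 := compT_is_sum n (entire_bin c s) hn.
rewrite !compT_monol frobz0 mul1r subr0 in h1 h2.
apply: (is_sum_unique h3); have := is_sumB h1 h2; apply: eq_is_sum => i.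
by rewrite -mulrBl.
Qed.

Lemma compT_binr c s g n : entire q g ->
  compT q g (binT c s) n = g n - g (n - s) * frob q (n - s) c.
Proof.
move=> hg; have hm c' s' := entire_coef_null (entire_mono q (c' : C) s').
have h1 := compT_is_sum n hg (hm 1 0).
have h2 := compT_is_sum n hg (hm c s).
have h3 := compT_is_sum n hg (entire_coef_null (entire_bin c s)).
rewrite !compT_monor frob1 mulr1 subr0 in h1 h2.
apply: (is_sum_unique h3); have := is_sumB h1 h2; apply: eq_is_sum => i.
by rewrite -mulrBr -frobB.
Qed.

(* [root_factor w] is the binomial with kernel Fq w whose constant term dominates
   at 1. *)
Definition root_coef w : C :=
  if absv w <= 1 then frob q (- 1) (w ^+ q.-1) else (w ^+ q.-1)^-1.

Definition root_shift w : int := if absv w <= 1 then - 1 else 1.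

Definition root_factor w : int -> C := binT (root_coef w) (root_shift w).

Lemma root_coef_le1 w : absv (root_coef w) <= 1.
Proof.
rewrite /root_coef; case: (leP (absv w) 1) => w1.
  by rewrite absv_frob_le1 absvX exprn_ile1 ?absv_ge0.
by rewrite absvV absvX invf_le1 ?exprn_gt0 ?(lt_trans ltr01) // exprn_ege1 // ltW.
Qed.

Lemma root_coef_lt1 w : root_shift w = 1 -> absv (root_coef w) < 1.
Proof.
rewrite /root_coef /root_shift; case: (leP (absv w) 1) => // w1 _.
rewrite absvV absvX invf_lt1 ?exprn_gt0 ?(lt_trans ltr01) // exprn_egt1 //.
by rewrite -lt0n -ltnS prednK ?fpow_gt1 ?fpow_gt0.
Qed.

Lemma root_shift_cases w : root_shift w = 1 \/ root_shift w = - 1.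
Proof. by rewrite /root_shift; case: ifP; [right|left]. Qed.

Lemma expr_predq w : w != 0 -> w ^+ q.-1 = w ^+ q / w.
Proof. by move=> w0; rewrite -[in RHS](prednK (fpow_gt0 q)) exprSr mulfK. Qed.

Lemma frob1E x : frob q 1 x = x ^+ q.
Proof. by rewrite /frob /= expn1. Qed.

Lemma root_factor_ker w x : evalT q (root_factor w) x = 0 ->
  exists2 c, Fq q c & x = c * w.
Proof.
rewrite evalT_bin => /eqP; rewrite subr_eq0 => /eqP xE.
have Fq0 : Fq q (0 : C) by rewrite /Fq /= expr0n gtn_eqF // fpow_gt0.
have [w0|w0] := eqVneq w 0.
  exists 0 => //; rewrite mul0r xE /root_coef w0 absv0 ler01 expr0n.
  by rewrite gtn_eqF ?frob0 ?mul0r // -ltnS prednK ?fpow_gt1 ?fpow_gt0.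
exists (x / w); last by rewrite divfK.
suff xq : x ^+ q = w ^+ q.-1 * x.
  rewrite /Fq /= exprMn exprVn xq expr_predq // mulrC !mulrA mulVf ?expf_neq0 //.
  by rewrite mul1r mulrC.
move: xE; rewrite /root_coef /root_shift; case: ifP => _ xE.
  by rewrite -frob1E {1}xE frobM !frobKV.
by rewrite {2}xE frob1E mulVKf // expf_neq0.
Qed.

Lemma root_factor_root w : evalT q (root_factor w) w = 0.
Proof.
have [->|w0] := eqVneq w 0; first by rewrite evalT0 //; exact: entire_bin.
rewrite evalT_bin /root_coef /root_shift; case: ifP => _.
  rewrite -frobM -exprSr prednK ?fpow_gt0 // -[w ^+ q]frob1E frobK.
  exact: subrr.
rewrite frob1E -[(q : nat) in X in _ * X](prednK (fpow_gt0 q)) exprS mulrCA.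
by rewrite mulVf ?mulr1 ?subrr // expf_neq0.
Qed.

(** The perturbation is strictly below 1 at indices k >= 0: for shift 1 because the binomial
    coefficient is, for shift -1 because it reads [h] at the positive index k + 1. *)
Lemma normalT_step h w : entire q h -> normalT h ->
  normalT (compT q (root_factor w) h).
Proof.
move=> hh [h0 h1 h2]; have c1 := root_coef_le1 w.
have le1 k : absv (root_coef w * frob q (root_shift w) (h (k - root_shift w))) <= 1.
  by rewrite absvM mulr_ile1 ?absv_ge0 // absv_frob_le1.
have lt1 k : 0 <= k ->
    absv (root_coef w * frob q (root_shift w) (h (k - root_shift w))) < 1.
  move=> k0; rewrite absvM; case: (root_shift_cases w) => sw.
    apply: le_lt_trans (root_coef_lt1 sw); rewrite ler_piMr ?absv_ge0 //.
    by rewrite absv_frob_le1.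
  apply: (@le_lt_trans _ _ (absv (frob q (root_shift w) (h (k - root_shift w))))).
    by rewrite ler_piMl ?absv_ge0.
  by rewrite absv_frob_lt1 h2 // sw; lia.
split=> [|k|k k0]; rewrite compT_binl //.
- by rewrite absvD_eq // absvN h0 lt1.
- by apply: absvB_le.
- by apply: absvB_lt; [exact: h2 | apply: lt1; exact: ltW].
Qed.

(** The division is the one defining the pairing: g w = G (1 - tau) gives g(z) = G(z/w - (z/w)^q),
    and this argument is a monomial applied to the value of the binomial at z. *)
Lemma root_factor_divides g w : entire q g -> evalT q g w = 0 ->
  exists2 g', entire q g' & g = compT q g' (root_factor w).
Proof.
move=> hg gw; have [w0|w0] := eqVneq w 0.
  exists g => //; apply/funext => n; rewrite compT_binr // /root_coef w0 absv0 ler01.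
  rewrite expr0n gtn_eqF ?frob0 ?mulr0 ?subr0 //.
  by rewrite -ltnS prednK ?fpow_gt1 ?fpow_gt0.
have [hG gE] := gT_spec hg gw; set G := gT _ _ _ in hG gE.
have ez z : evalT q g z = evalT q G (z / w - (z / w) ^+ q).
  have := congr1 (fun a => evalT q a (z / w)) gE.
  rewrite !evalT_comp //; [|exact: entire_one_sub_tau|exact: entire_mono].
  by rewrite evalT_const mulrC divfK // evalT_one_sub_tau.
have build c s : (forall z, c * frob q s (evalT q (root_factor w) z) =
    z / w - (z / w) ^+ q) ->
    exists2 g', entire q g' & g = compT q g' (root_factor w).
  move=> hcs; have hm := entire_mono q c s.
  have hGm := entire_comp hG hm; have hr := entire_bin (root_coef w) (root_shift w).
  exists (compT q G (monoT c s)) => //; apply: (@evalT_inj _ _ q) => //.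
    exact: entire_comp.
  by move=> z; rewrite (evalT_comp z hGm hr) (evalT_comp _ hG hm) evalT_mono hcs.
have wq0 : w ^+ q != 0 by rewrite expf_neq0.
have [w1|w1] := leP (absv w) 1.
  apply: (build (- (w ^+ q)^-1) 1) => z; rewrite evalT_bin /root_coef /root_shift w1.
  rewrite frobB frobM !frobKV frob1E expr_predq // mulNr mulrBr opprB.
  rewrite exprMn exprVn [z ^+ q / _]mulrC; congr (_ - _).
  by rewrite !mulrA mulVf // mul1r mulrC.
apply: (build w^-1 0) => z; rewrite evalT_bin /root_coef /root_shift.
case: ifP => [|_]; first by rewrite leNgt w1.
rewrite frobz0 frob1E expr_predq // mulrBr [w^-1 * z]mulrC; congr (_ - _).
by rewrite invf_div mulrA mulrA mulVf // mul1r exprMn exprVn mulrC.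
Qed.

(** The last maximal coefficient of [g'] survives in [g] as its last maximal one, so it sits at
    index 0 with absolute value 1. *)
Lemma normalT_quotient g g' w : entire q g' -> normalT g ->
  g = compT q g' (root_factor w) -> normalT g'.
Proof.
move=> hg' [n0 n1 n2] gE; have c1 := root_coef_le1 w.
have [|j [gj hj hj']] := null_int_max (entire_coef_null hg').
  apply: contrapT => h; have g'0 : g' = fun=> 0.
    by apply/funext => k; apply/eqP; apply: contraT => gk; case: h; exists k.
  move: n0; rewrite gE compT_binr // g'0 mul0r subr0 absv0 => /esym/eqP.
  by rewrite oner_eq0.
set M := absv (g' j) in hj hj'; have M0 : 0 < M by rewrite absv_gt0.
have gk k : g k = g' k - g' (k - root_shift w) * frob q (k - root_shift w) (root_coef w).
  by rewrite gE compT_binr.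
have le2 k : absv (g' (k - root_shift w) * frob q (k - root_shift w) (root_coef w)) <= M.
  rewrite absvM; apply: le_trans (hj (k - root_shift w)).
  by rewrite ler_piMr ?absv_ge0 // absv_frob_le1.
have lt2 k : j <= k ->
    absv (g' (k - root_shift w) * frob q (k - root_shift w) (root_coef w)) < M.
  move=> jk; rewrite absvM; case: (root_shift_cases w) => sw.
    apply: (@le_lt_trans _ _ (M * absv (frob q (k - root_shift w) (root_coef w)))).
      by rewrite ler_wpM2r ?absv_ge0.
    by rewrite gtr_pMr // absv_frob_lt1 root_coef_lt1.
  apply: (@le_lt_trans _ _ (absv (g' (k - root_shift w)))).
    by rewrite ler_piMr ?absv_ge0 // absv_frob_le1.
  by apply: hj'; rewrite sw; lia.
have gM k : absv (g k) <= M by rewrite gk; apply: absvB_le.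
have gltM k : j < k -> absv (g k) < M.
  by move=> jk; rewrite gk; apply: absvB_lt; [exact: hj' | apply: lt2; exact: ltW].
have gjM : absv (g j) = M by rewrite gk absvD_eq // absvN lt2.
have M1 : M = 1 by apply/eqP; rewrite eq_le -{1}gjM n1 -n0 gM.
have j0 : j = 0.
  have [j0|j0|//] := ltgtP j 0.
    by have := gltM _ j0; rewrite n0 M1 ltxx.
  by have := n2 _ j0; rewrite gjM M1 ltxx.
by split; [rewrite -M1 -j0 | rewrite -M1 | rewrite -M1 -j0].
Qed.

(** Multiplicativity of the Gauss norm, one inequality. The norm of [h] at [z] is |y| for a term [y]
    of [C], at which [g] is then measured. Both dominant indices being the last ones, a single
    product dominates the coefficient of index j0 + k0. *)
Lemma comp_dominant_term g h z : entire q g -> entire q h -> z != 0 ->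
  (exists k, h k != 0) ->
  exists2 k0, forall k, absv (h k * frob q k z) <= absv (h k0 * frob q k0 z) &
    forall j, exists n, absv (g j * frob q j (h k0 * frob q k0 z)) <=
                        absv (compT q g h n * frob q n z).
Proof.
move=> hg hh z0 [k1 hk1].
have [|k0 [y0 max_k0 last_k0]] := null_int_max (entire_null z hh).
  by exists k1; rewrite mulf_neq0 ?frob_eq0.
exists k0 => //; set y := h k0 * _ in y0 max_k0 last_k0 *.
have [[j1 gj1]|g0] := pselect (exists j, g j != 0); last first.
  move=> j; exists 0; have -> : g j = 0.
    by apply/eqP; apply: contraT => gj; case: g0; exists j.
  by rewrite mul0r absv0 absv_ge0.
have [|j0 [gy0 max_j0 last_j0]] := null_int_max (entire_null y hg).
  by exists j1; rewrite mulf_neq0 ?frob_eq0.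
move=> j; exists (j0 + k0); apply: le_trans (max_j0 j) _.
have hs : is_sum (fun i => g i * frob q i (h (j0 + k0 - i) * frob q (j0 + k0 - i) z))
    (compT q g h (j0 + k0) * frob q (j0 + k0) z).
  rewrite mulrC; have hc := compT_is_sum (j0 + k0) hg (entire_coef_null hh).
  have := is_sumZ (frob q (j0 + k0) z) hc.
  by apply: eq_is_sum => i; rewrite frobM -frobzD subrKC mulrC mulrA.
have e0 : j0 + k0 - j0 = k0 by rewrite addrAC subrr add0r.
rewrite (is_sum_dominant hs (k := j0)) e0 // => i ij.
have [ltij|ltji|/eqP] := ltgtP i j0; last by rewrite (negbTE ij).
  have [->|gi] := eqVneq (g i) 0; first by rewrite mul0r absv0 absv_gt0.
  apply: lt_le_trans (max_j0 i); rewrite !absvM ltr_pM2l ?absv_gt0 //.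
  by rewrite absv_frob_lt last_k0 //; lia.
apply: le_lt_trans (last_j0 _ ltji); rewrite !absvM ler_wpM2l ?absv_ge0 //.
by rewrite absv_frob_le.
Qed.

(** The constant term of either normalised factor has absolute value 1 and cannot shrink the other.
    Estimates for the product thus hold for all its normalised factors at once. *)
Lemma normalT_comp_bound g h z : entire q g -> entire q h -> normalT g -> normalT h ->
  (forall k, exists n, absv (h k * frob q k z) <= absv (compT q g h n * frob q n z)) /\
  (forall k, exists n, absv (g k * frob q k z) <= absv (compT q g h n * frob q n z)).
Proof.
move=> hg hh [g0 g1 _] [h0 h1 _]; have [->|z0] := eqVneq z 0.
  by split=> k; exists 0; rewrite !frob0 !mulr0.
have [|k0 mk hk] := comp_dominant_term hg hh z0.
  by exists 0; rewrite -absv_gt0 h0.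
split=> k.
  have [n hn] := hk 0; exists n; apply: le_trans (mk k) _; apply: le_trans hn.
  by rewrite frobz0 [leRHS]absvM g0 mul1r.
have [n hn] := hk k; exists n; apply: le_trans hn; rewrite !absvM ler_wpM2l ?absv_ge0 //.
rewrite absv_frob_le; apply: le_trans (mk 0).
by rewrite frobz0 absvM h0 mul1r.
Qed.

Lemma root_coef_small eps : 0 < eps -> exists2 eta : R, 0 < eta &
  forall w, ~~ (eta <= absv w <= eta^-1) -> absv (root_coef w) < eps.
Proof.
(* The power eps^q serves small w, where the coefficient involves a q-th root; eps serves large
   w. *)
move=> e0; pose eta := Num.min (Num.min 1 eps) (eps ^+ q).
have eta0 : 0 < eta by rewrite !lt_min ltr01 e0 exprn_gt0.
have eta1 : eta <= 1 by rewrite !ge_min lexx.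
have q0 : (0 < q.-1)%N by rewrite -ltnS prednK ?fpow_gt1 ?fpow_gt0.
exists eta => // w; rewrite negb_and -!ltNge /root_coef.
have [w1|w1] := leP (absv w) 1 => /orP[wlt|wgt].
- rewrite -(@ltr_pXn2r _ q) ?fpow_gt0 ?nnegrE ?absv_ge0 ?(ltW e0) //.
  rewrite -absvX -frob1E frobKV absvX.
  apply: (@le_lt_trans _ _ (absv w)).
    by rewrite -[leRHS]expr1 ler_wiXn2l ?absv_ge0.
  by apply: lt_le_trans wlt _; rewrite !ge_min lexx orbT.
- have : 1 < absv w by apply: le_lt_trans wgt; rewrite invf_ge1.
  by rewrite ltNge w1.
- by have := lt_le_trans wlt eta1; rewrite ltNge (ltW w1).
rewrite absvV absvX; have w0 : 0 < absv w by exact: lt_trans w1.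
apply: (@le_lt_trans _ _ (absv w)^-1).
  rewrite lef_pV2 ?posrE ?exprn_gt0 // -[leLHS]expr1.
  by rewrite ler_weXn2l // ltW.
apply: (@lt_le_trans _ _ eta); last by rewrite !ge_min lexx orbT.
by rewrite -[eta]invrK ltf_pV2 ?posrE ?invr_gt0.
Qed.

(** The root to add is the value of the current divisor at [v m], so that the kernel grows by F_q (v
    m). If [v m] is already a zero, that value is 0 and the factor is the identity. *)
Fixpoint divisor_seq (v : nat -> C) (n : nat) : int -> C :=
  if n is m.+1 then
    compT q (root_factor (evalT q (divisor_seq v m) (v m))) (divisor_seq v m)
  else monoT 1 0.

Definition limT (h_ : nat -> int -> C) : int -> C := fun k => limn (fun n => h_ n k).

Definition divisor_lim (v : nat -> C) : int -> C := limT (divisor_seq v).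

Lemma entire_divisor_seq v n : entire q (divisor_seq v n).
Proof.
elim: n => [|n IH] /=; first exact: entire_mono.
by apply: entire_comp => //; exact: entire_bin.
Qed.

Lemma normalT_divisor_seq v n : normalT (divisor_seq v n).
Proof.
elim: n => [|n IH] /=; last by apply: normalT_step => //; exact: entire_divisor_seq.
rewrite /monoT; split=> [|k|k k0]; first by rewrite eqxx absv1.
  by case: ifP; rewrite ?absv1 ?absv0.
by rewrite gt_eqF // absv0.
Qed.

Lemma divisor_seq_ker_mono v n m : (n <= m)%N ->
  kerT q (divisor_seq v n) `<=` kerT q (divisor_seq v m).
Proof.
move=> /subnK <-; elim: (m - n)%N => [|i IH] // z /IH.
by rewrite addSn; apply: kerT_comp; [exact: entire_bin | exact: entire_divisor_seq].
Qed.

Lemma divisor_seq_root v n : kerT q (divisor_seq v n.+1) (v n).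
Proof.
rewrite /kerT /= evalT_comp; [exact: root_factor_root|exact: entire_bin|].
exact: entire_divisor_seq.
Qed.

Lemma divisor_seq_ker_sub v H n : Fq_subspace q H -> (forall i, H (v i)) ->
  kerT q (divisor_seq v n) `<=` H.
Proof.
move=> [H0 HD HZ] Hv; have hd := entire_divisor_seq v; elim: n => [|n IH] z.
  by rewrite /kerT /= evalT_mono frobz0 mul1r => ->.
rewrite /kerT /= evalT_comp //; last exact: entire_bin.
move=> /root_factor_ker[c hc zE]; rewrite -[z](subrK (c * v n)); apply: HD.
  by apply: IH; rewrite /kerT /= evalTB // evalT_Fq // zE subrr.
exact: HZ.
Qed.

Section Limit.
Variable h_ : nat -> int -> C.
Hypothesis h_entire : forall n, entire q (h_ n).
Hypothesis h_cauchy : forall z eps, 0 < eps -> exists N : nat, forall n, (N <= n)%N ->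
  forall k, absv ((h_ n.+1 k - h_ n k) * frob q k z) < eps.

(** Convergence is uniform in [k] at each [z], that is, in every Gauss norm; convergence of each
    coefficient alone would not keep the limit entire. *)
Lemma limT_close z eps : 0 < eps -> exists N : nat, forall n, (N <= n)%N ->
  forall k, absv ((limT h_ k - h_ n k) * frob q k z) < eps.
Proof.
move=> e0; have [N hN] := h_cauchy z e0; exists N => n Nn k.
have cv : cvgn (fun n => h_ n k).
  apply: absv_complete => d d0; have [M hM] := h_cauchy 1 d0.
  by exists M => m Mm; have := hM _ Mm k; rewrite frob1 mulr1.
have [d d0 hd] := mulr_small (frob q k z) e0.
have [M hM] := (cvgn_absvP _ _).1 cv _ d0.
pose m := maxn M N.
rewrite mulrBl; apply: (@absv_dist_lt _ _ (h_ m k * frob q k z)).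
  by rewrite -mulrBl mulrC; apply: hd; apply: hM; exact: leq_maxl.
have := @absv_telescope _ _ (fun m => h_ m k * frob q k z) eps N e0.
apply=> // [i Ni|]; last exact: leq_maxr.
by rewrite -mulrBl; exact: hN.
Qed.

Lemma entire_limT : entire q (limT h_).
Proof.
apply/entireP => z eps e0; have [N hN] := limT_close z e0.
have [s hs] := entire_null z (h_entire N) e0.
exists s => k /hs hk; rewrite -[limT h_ k](subrK (h_ N k)) mulrDl.
by apply: absvD_lt => //; exact: hN.
Qed.

Lemma evalT_limT_close z eps : 0 < eps -> exists N : nat, forall n, (N <= n)%N ->
  absv (evalT q (limT h_) z - evalT q (h_ n) z) < eps.
Proof.
move=> e0; have [N hN] := limT_close z e0; exists N => n Nn.
have hl := entire_limT; rewrite -evalT_subl //.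
by apply: evalT_lt => //; [exact: entireB | exact: hN].
Qed.

End Limit.

Section NormalDivisor.
Variables (f : int -> C) (v : nat -> C).
Hypotheses (f_entire : entire q f) (f_normal : normalT f).
Hypothesis v_ker : forall n, kerT q f (v n).
Let h_ := divisor_seq v.
Let w_ n := evalT q (h_ n) (v n).

(** As 0 = f(v n) = g(h_n(v n)), the value [w_ n] is a root of the quotient, and its binomial moves
    from [g] to [h_ n]. *)
Lemma divisor_seq_quotient n :
  exists g, [/\ entire q g, normalT g & f = compT q g (h_ n)].
Proof.
elim: n => [|n [g [hg ng fE]]].
  exists f; split=> //; apply/funext => n.
  by rewrite compT_monor frob1 mulr1 subr0.
have hn := entire_divisor_seq v n.
have [|g' hg' gE] := @root_factor_divides g (w_ n) hg.
  by have := v_ker n; rewrite /kerT /= {1}fE evalT_comp.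
exists g'; split=> //; first exact: normalT_quotient gE.
by rewrite fE gE -compTA //; exact: entire_bin.
Qed.

(* A value w_n of intermediate size would come from a zero of f of bounded size
   which is far from the zeros of h_n: by total boundedness there are finitely
   many such n. *)
Lemma root_coef_cvg eps : 0 < eps -> exists N : nat, forall n, (N <= n)%N ->
  absv (root_coef (w_ n)) < eps.
Proof.
move=> e0; have [eta eta0 heta] := root_coef_small e0.
have [d d0 hd] := evalT_small f_entire eta0.
have [L hL] := kerT_totally_bounded eta^-1 f_entire (normalT_neq0 f_normal) d0.
have hh := entire_divisor_seq v.
pose P n x := [/\ kerT q (h_ n.+1) x, kerT q f x, absv x <= eta^-1 &
                  forall y, kerT q (h_ n) y -> d <= absv (x - y)].
have Pex n : eta <= absv (w_ n) <= eta^-1 -> exists x, P n x.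
  move=> /andP[w1 w2]; have [c0 c1 _] := normalT_divisor_seq v n.
  have hn0 : h_ n 0 != 0 by rewrite -absv_gt0 c0.
  have [|x hx xw] := @evalT_surj _ _ q (h_ n) 0 (w_ n) ((h_ n 0)^-1 * w_ n) (hh n) hn0.
    by rewrite frobz0 mulVKf.
  have [g [hg ng fE]] := divisor_seq_quotient n.
  exists x; split.
  - rewrite /kerT /= evalT_comp //; last exact: entire_bin.
    by rewrite -/(h_ n) hx root_factor_root.
  - have := v_ker n; rewrite /kerT /= fE !evalT_comp //.
    by rewrite -/(w_ n) -hx.
  - by apply: le_trans xw _; rewrite absvM absvV c0 invr1 mul1r.
  - move=> y ky; rewrite leNgt; apply/negP => xy.
    have : absv (w_ n) < eta; last by rewrite ltNge w1.
    have -> : w_ n = evalT q (h_ n) (x - y) by rewrite evalTB // ky subr0.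
    apply: evalT_lt => // k.
    have nh := normalT_divisor_seq v n.
    have [/(_ k)[m hm] _] := normalT_comp_bound (x - y) hg (hh n) ng nh.
    by apply: le_lt_trans hm _; rewrite -fE; exact: hd.
(* Pigeonhole: two such points from different stages near the same [l] would be closer than [d], yet
   the earlier one is a zero of every later divisor. *)
have [N hN] : exists N : nat, forall n x, (N <= n)%N -> P n x ->
    forall l, l \in L -> d <= absv (x - l).
  elim: L {hL} => [|l L [N IH]]; first by exists 0%N.
  have [[n0 [x0 [P0 xl0]]]|none] :=
      pselect (exists n0 x0, P n0 x0 /\ absv (x0 - l) < d); last first.
    exists N => n x Nn Px l'; rewrite inE => /predU1P[->|]; last exact: IH Px _.
    by rewrite leNgt; apply/negP => xl; apply: none; exists n, x.
  exists (maxn N n0.+1) => n x; rewrite geq_max => /andP[Nn n0n] Px l'.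
  rewrite inE => /predU1P[->|]; last exact: IH Px _.
  rewrite leNgt; apply/negP => xl; have [k0 _ _ _] := P0.
  have [_ _ _ /(_ x0)] := Px; rewrite leNgt => /(_ _)/negP; apply.
    exact: divisor_seq_ker_mono n0n _ k0.
  by apply: (absv_dist_lt xl); rewrite absvB.
exists N => n Nn; apply: heta; apply/negP => /Pex[x Px].
have [_ kx xr _] := Px; have [l lL xl] := hL _ kx xr.
by have := hN _ _ Nn Px _ lL; rewrite leNgt xl.
Qed.

(** The increment is -c tau^s composed with [h_ n], whose terms at [z] are bounded by those of [f],
    while c tends to 0. *)
Lemma divisor_seq_cauchy z eps : 0 < eps -> exists N : nat, forall n, (N <= n)%N ->
  forall k, absv ((h_ n.+1 k - h_ n k) * frob q k z) < eps.
Proof.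
move=> e0; have [Y hY] := null_bounded (entire_null z f_entire).
have [d1 d10 hd1] := mulr_small (frob q 1 Y) e0.
have [d2 d20 hd2] := mulr_small (frob q (- 1) Y) e0.
have dd : 0 < Num.min d1 d2 by rewrite lt_min d10.
have [N hN] := root_coef_cvg dd; exists N => n Nn k.
have := hN _ Nn; rewrite lt_min => /andP[c1 c2].
have hn := entire_divisor_seq v n.
rewrite [h_ n.+1 k]compT_binl // -/(h_ n) -/(w_ n) addrAC subrr sub0r.
set s := root_shift _; set c := root_coef _ in c1 c2 *.
rewrite mulNr absvN -mulrA -{2}(subrKC s k) frobzD -frobM.
have [g [hg ng fE]] := divisor_seq_quotient n.
have [/(_ (k - s))[m hm] _] := normalT_comp_bound z hg hn ng (normalT_divisor_seq v n).
rewrite -fE in hm.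
apply: (@le_lt_trans _ _ (absv (c * frob q s Y))).
  by rewrite !absvM ler_wpM2l ?absv_ge0 // absv_frob_le (le_trans hm) ?hY.
rewrite mulrC /s; case: (root_shift_cases (w_ n)) => ->; [exact: hd1 | exact: hd2].
Qed.

Lemma divisor_lim_spec : entire q (divisor_lim v) /\
  exists2 g, entire q g & f = compT q g (divisor_lim v).
Proof.
have hh := entire_divisor_seq v.
have hl : entire q (divisor_lim v) := entire_limT hh divisor_seq_cauchy.
split=> //; have /choice[g_ hg_] := divisor_seq_quotient.
have ge n : entire q (g_ n) by have [] := hg_ n.
have gn n : normalT (g_ n) by have [] := hg_ n.
have gf n : f = compT q (g_ n) (h_ n) by have [] := hg_ n.
(* Equicontinuity of all the quotients, inherited from [f]: it makes them converge and allows the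
   limit in f(z) = g_n(h_n(z)). *)
have g_small eps : 0 < eps -> exists2 d, 0 < d & forall x, absv x < d ->
    forall n k, absv (g_ n k * frob q k x) < eps.
  move=> e0; have [d d0 hd] := evalT_small f_entire e0; exists d => // x xd n k.
  have nh := normalT_divisor_seq v n.
  have [_ /(_ k)[m hm]] := normalT_comp_bound x (ge n) (hh n) (gn n) nh.
  by apply: le_lt_trans hm _; rewrite -gf; exact: hd.
have gS n : g_ n = compT q (g_ n.+1) (root_factor (w_ n)).
  apply: (@compT_rcancel _ _ q _ _ (h_ n)) => //.
  - by apply: entire_comp => //; exact: entire_bin.
  - exact/normalT_neq0/normalT_divisor_seq.
  by rewrite -gf -compTA // ?{1}(gf n.+1) //; exact: entire_bin.
have g_cauchy z eps : 0 < eps -> exists N : nat, forall n, (N <= n)%N ->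
    forall k, absv ((g_ n.+1 k - g_ n k) * frob q k z) < eps.
  move=> e0; have [d d0 hd] := g_small _ e0.
  have [d1 d10 hd1] := mulr_small (frob q 1 z) d0.
  have [d2 d20 hd2] := mulr_small (frob q (- 1) z) d0.
  have dd : 0 < Num.min d1 d2 by rewrite lt_min d10.
  have [N hN] := root_coef_cvg dd; exists N => n Nn k.
  have := hN _ Nn; rewrite lt_min => /andP[c1 c2].
  rewrite [g_ n k](congr1 (fun u => u k) (gS n)) compT_binr //.
  set s := root_shift _; set c := root_coef _ in c1 c2 *.
  have -> : frob q k z = frob q (k - s) (frob q s z) by rewrite -frobzD subrK.
  rewrite subKr -mulrA -frobM; apply: hd; rewrite mulrC /s.
  case: (root_shift_cases (w_ n)) => ->; [exact: hd1 | exact: hd2].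
have hg : entire q (limT g_) := entire_limT ge g_cauchy.
exists (limT g_) => //; apply: (@evalT_inj _ _ q) => //; first exact: entire_comp.
move=> z; rewrite evalT_comp //; apply/eqP; rewrite -subr_eq0.
apply/eqP/absv_small_eq0 => eps e0; set y := evalT q (divisor_lim v) z.
have [d d0 hd] := g_small _ e0.
have [N1 hN1] := evalT_limT_close hh divisor_seq_cauchy z d0.
have [N2 hN2] := evalT_limT_close ge g_cauchy y e0.
pose n := maxn N1 N2.
apply: (@absv_dist_lt _ _ (evalT q (g_ n) y)); last first.
  by rewrite absvB; apply: hN2; exact: leq_maxr.
rewrite (gf n) evalT_comp // -evalTB //; apply: evalT_lt => // k; apply: hd.
by rewrite absvB; apply: hN1; exact: leq_maxl.
Qed.

(** At a zero z of the limit, h_N(z) is small; as |h_N 0| = 1, controlled surjectivity moves z by at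
    most |h_N(z)| to a zero of h_N, which lies in [H]. *)
Lemma kerT_divisor_lim H : Fq_subspace q H -> closed H ->
  (forall n, H (v n)) ->
  (forall z eps, H z -> 0 < eps -> exists n, absv (z - v n) < eps) ->
  kerT q (divisor_lim v) = H.
Proof.
move=> Hs Hc Hv Hd; have hh := entire_divisor_seq v; have [hl _] := divisor_lim_spec.
apply/seteqP; split=> z Hz.
  apply: (closed_absvP H).1 Hc _ _ => eps e0.
  have [N hN] := evalT_limT_close hh divisor_seq_cauchy z e0.
  have := hN _ (leqnn N); rewrite [evalT q (limT _) z]Hz sub0r absvN => hw.
  set w := evalT q _ z in hw; have [c0 _ _] := normalT_divisor_seq v N.
  have hn0 : h_ N 0 != 0 by rewrite -absv_gt0 c0.
  have [|x hx xw] := @evalT_surj _ _ q (h_ N) 0 w ((h_ N 0)^-1 * w) (hh N) hn0.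
    by rewrite frobz0 mulVKf.
  exists (z - x); last first.
    by rewrite subKr; apply: le_lt_trans xw _; rewrite absvM absvV c0 invr1 mul1r.
  by apply: (divisor_seq_ker_sub (n := N) Hs Hv); rewrite /kerT /= evalTB // hx subrr.
apply: (closed_absvP _).1 (closed_kerT hl) _ _ => eps e0.
have [n zn] := Hd _ _ Hz e0; exists (v n) => //.
apply: absv_small_eq0 => d d0.
have [N hN] := evalT_limT_close hh divisor_seq_cauchy (v n) d0.
have := hN (maxn N n.+1) (leq_maxl _ _).
by rewrite (divisor_seq_ker_mono (leq_maxr _ _) (divisor_seq_root v n)) subr0.
Qed.

End NormalDivisor.

Lemma normalT_ex f : entire q f -> f <> (fun=> 0) ->
  exists f0 c i, [/\ entire q f0, normalT f0, kerT q f0 = kerT q f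
                   & f = compT q (monoT c i) f0].
Proof.
move=> hf f_neq0; have [|i [fi mi li]] := null_int_max (entire_coef_null hf).
  apply: contrapT => h; apply: f_neq0; apply/funext => n; apply/eqP.
  by apply: contraT => fn; case: h; exists n.
pose m := monoT (frob q (- i) (f i)^-1) (- i).
have hm : entire q m by exact: entire_mono.
have h0 : entire q (compT q m f) by exact: entire_comp.
have ev z : evalT q (compT q m f) z = frob q (- i) ((f i)^-1 * evalT q f z).
  by rewrite evalT_comp // evalT_mono frobM.
have fi0 : 0 < absv (f i) by rewrite absv_gt0.
exists (compT q m f), (f i), i; split=> //.
- split=> [|k|k k0]; rewrite compT_monol -frobM opprK.
  + by rewrite add0r mulVf // frob1 absv1.
  + by rewrite absv_frob_le1 absvM absvV mulrC ler_pdivrMr // mul1r.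
  + rewrite absv_frob_lt1 absvM absvV mulrC ltr_pdivrMr // mul1r.
    by apply: li; lia.
- apply/seteqP; split=> z; rewrite /kerT /= ev; last by move=> ->; rewrite mulr0 frob0.
  by move=> /eqP; rewrite frob_eq0 mulf_eq0 invr_eq0 (negbTE fi) /= => /eqP.
have hmi := entire_mono q (f i) i.
apply: (@evalT_inj _ _ q) => //; first exact: entire_comp.
by move=> z; rewrite (evalT_comp z hmi) // evalT_mono ev frobKV mulVKf.
Qed.

(* The divisor depends on the dense sequence only, not on f: this is what makes
   two multiples with the same kernel comparable. *)
Lemma divisor_lim_divides f v H : entire q f -> f <> (fun=> 0) ->
  H `<=` kerT q f -> Fq_subspace q H -> closed H -> (forall n, H (v n)) ->
  (forall z eps, H z -> 0 < eps -> exists n, absv (z - v n) < eps) ->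
  [/\ entire q (divisor_lim v), kerT q (divisor_lim v) = H &
      exists2 g, entire q g & f = compT q g (divisor_lim v)].
Proof.
move=> hf f_neq0 Hk Hs Hc Hv Hd.
have [f0 [c [i [hf0 nf0 kf0 fE]]]] := normalT_ex hf f_neq0.
have vk n : kerT q f0 (v n) by rewrite kf0; exact: Hk.
have [hl [g hg f0E]] := divisor_lim_spec hf0 nf0 vk.
split=> //; first exact: (kerT_divisor_lim hf0 nf0 vk).
exists (compT q (monoT c i) g); first by apply: entire_comp => //; exact: entire_mono.
by rewrite fE f0E compTA //; exact: entire_mono.
Qed.

Lemma maximal_isotropic_factor f H : entire q f -> f <> (fun=> 0) -> f = adjT q f ->
  maximal_isotropic_closed_subspace q f H ->
  exists h, [/\ entire q h, f = compT q (adjT q h) h & kerT q h = H].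
Proof.
move=> hf f0 fs Hmax; have [[Hk Hs Hc Hiso] _] := Hmax.
have {}Hc : closed H by apply/(closed_in_kerT hf).
have [H0 _ _] := Hs.
have [v Hv Hd] := kerT_subset_separable hf f0 Hk H0.
have [hh kh [g hg fE]] := divisor_lim_divides hf f0 Hk Hs Hc Hv Hd.
set h := divisor_lim v in hh kh fE.
have ha := entire_adj hh; have hga := entire_adj hg.
have h0 : h <> (fun=> 0).
  move=> h0; have [z] := evalT_onto 1 hf f0.
  rewrite fE evalT_comp // h0 evalT_zero evalT0 //.
  by move=> /esym/eqP; rewrite oner_eq0.
have ga0 : adjT q g <> (fun=> 0).
  move=> ga0; have [z] := evalT_onto 1 hf f0; rewrite fE evalT_comp //.
  have -> : g = fun=> 0.
    by rewrite -(adjTK q g) ga0; apply/funext => n; rewrite /adjT frob0.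
  by rewrite evalT_zero => /esym/eqP; rewrite oner_eq0.
have fE' z : evalT q f z = evalT q (adjT q h) (evalT q (adjT q g) z).
  by rewrite fs fE adjT_comp // evalT_comp.
have pE alpha beta : H alpha ->
    pairing q f alpha beta = pairing q h alpha (evalT q (adjT q g) beta).
  by rewrite -kh => ka; rewrite fE pairing_comp.
(* Isotropy makes (adj g)(beta) orthogonal to ker h = H, so nondegeneracy kills it. *)
have Hg : H `<=` kerT q (adjT q g).
  move=> beta Hb; apply: (@pairing_nondegenerate _ _ q h) => //.
    by rewrite /kerT /= -fE'; exact: Hk.
  by rewrite kh => alpha Ha; rewrite -pE // Hiso.
have gH : kerT q (adjT q g) `<=` H.
  move=> beta gb; apply: (maximal_isotropic_perp hf fs Hmax).
    by rewrite /kerT /= fE' gb evalT0.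
  move=> alpha Ha; rewrite pE // gb /pairing evalT0 //; apply: entire_adj.
  by apply: entire_gT => //; rewrite kh.
have [_ _ [u hu gE]] := divisor_lim_divides hga ga0 Hg Hs Hc Hv Hd.
rewrite -/h in gE; have hua := entire_adj hu.
have gE' : g = compT q (adjT q h) (adjT q u) by rewrite -adjT_comp // -gE adjTK.
have u0 : u <> (fun=> 0).
  move=> u0; have [z] := evalT_onto 1 hga ga0; rewrite gE evalT_comp // u0 evalT_zero.
  by move=> /esym/eqP; rewrite oner_eq0.
(* Since [h] is onto, a zero of [u] is h(y) with y in ker (adj g), contained in H = ker h. *)
have ku z : evalT q u z = 0 -> z = 0.
  have [y <-] := evalT_onto z hh h0; rewrite -evalT_comp // -gE => /gH.
  by rewrite -kh.
(* Both (adj h)(adj u) h and (adj h) u h equal [f], and the outer factors cancel. *)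
have uself : adjT q u = u.
  have ah0 : adjT q h <> (fun=> 0).
    move=> ah0; apply: h0; rewrite -(adjTK q h) ah0.
    by apply/funext => n; rewrite /adjT frob0.
  apply: (compT_lcancel hua hu ha ah0).
  apply: (@compT_rcancel _ _ q _ _ h) => //; try exact: entire_comp.
  rewrite -gE' -fE fs fE adjT_comp // gE compTA //.
have [n [c c0 uE]] := kerT0_mono hu u0 ku.
(* The adjoint of a monomial of index n has index -n. *)
have n0 : n = 0.
  have := congr1 (fun u' => u' n) uself; rewrite uE adjT_mono /monoT eqxx.
  by case: eqP => [nn _|_ /esym/eqP]; [lia | rewrite (negbTE c0)].
(* A constant is its own adjoint, so the factor b h contributes b on both sides of the middle,
   giving b^2 = c. *)
have [b bE] : exists b : C, b * b = c.
  pose P (i : nat) := if i == 0%N then c else 0.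
  have [b hb] := solve_monicpoly P (isT : (0 < 2)%N).
  exists b; rewrite -expr2 hb big_ord_recl big_ord1 /= expr0 mulr1.
  by rewrite mul0r addr0.
have b0 : b != 0 by apply: contraNneq c0 => b0; rewrite -bE b0 mul0r.
have hb : entire q (constT b) := entire_mono q b 0.
have hbh := entire_comp hb hh.
exists (compT q (constT b) h); split=> //.
  have hX := entire_comp (entire_adj hbh) hbh.
  apply: (@evalT_inj _ _ q) => // z.
  rewrite (evalT_comp z (entire_adj hbh) hbh) adjT_comp // adjT_const.
  rewrite !evalT_comp // !evalT_const mulrA bE.
  have hc : entire q (constT c) := entire_mono q c 0.
  rewrite fE gE' uself uE n0 -constTE (evalT_comp z (entire_comp ha hc) hh).
  by rewrite (evalT_comp _ ha hc) evalT_const.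
rewrite -kh; apply/seteqP; split=> z; rewrite /kerT /= evalT_comp // evalT_const.
  by move=> /eqP; rewrite mulf_eq0 (negbTE b0) /= => /eqP.
by move=> ->; rewrite mulr0.
Qed.

End Divisor.

Theorem theorem8p10 (R : realType) (C : completeNonarchClosedFieldType R)
    (p e q : nat) (p_prime : prime p) (e_gt0 : (0 < e)%N) (qE : q = (p ^ e)%N)
    (charC : p \in [pchar C])
    (f : int -> C) (f_entire : entire q f) (f_neq0 : f <> (fun=> 0))
    (f_selfadj : f = adjT q f) :
  [/\ forall alpha : C, kerT q f alpha -> pairing q f alpha alpha = 0,
      forall h : int -> C, entire q h -> f = compT q (adjT q h) h ->
        maximal_isotropic_closed_subspace q f (kerT q h)
    & forall H : set C, maximal_isotropic_closed_subspace q f H ->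
        exists h : int -> C,
          [/\ entire q h, f = compT q (adjT q h) h & kerT q h = H]].
Proof.
have q_gt1 : (1 < q)%N.
  by rewrite qE -[X in (X < _)%N](expn0 p) ltn_exp2l ?prime_gt1.
have q_pchar : [pchar C].-nat q by rewrite qE pnatX pnatE // charC.
pose Q : frobenius_power C := FrobeniusPower q_gt1 q_pchar.
split=> [alpha ka|h hh fE|H Hmax].
- exact: (@pairing_alternating _ _ Q).
- exact: (@comp_adj_maximal_isotropic _ _ Q).
- exact: (@maximal_isotropic_factor _ _ Q).
Qed.
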